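(* Let $\varepsilon>0$. There exists $c>0$ such that for every $b>c$ and every conformal embedding $\varphi:B(b)/\mathbb{Z}\to\mathbb{C}/\mathbb{Z}$ with $\varphi(0)=0$ and $\varphi_*(1)=1$ on fundamental groups, the restriction of $\varphi$ to $B(b-c)/\mathbb{Z}$ is within $\varepsilon$ of the identity.
   Context: For $b>0$, $B(b)=\{z\in\mathbb{C}:|\operatorname{Im}z|<b\}$, and $B(b)/\mathbb{Z}$ is its quotient by $z\mapsto z+1$, a subcylinder of $\mathbb{C}/\mathbb{Z}$. Fundamental groups of $B(b)/\mathbb{Z}$ and $\mathbb{C}/\mathbb{Z}$ are both identified with $\mathbb{Z}$ (generated by the image of $[0,1]$). ''Within $\varepsilon$ of the identity'' means the Euclidean distance in $\mathbb{C}/\mathbb{Z}$ between $\varphi(z)$ and $z$ is at most $\varepsilon$ for every $z\in B(b-c)/\mathbb{Z}$. *)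

(* Defs.v *)
From Stdlib Require Import Reals.
From Coquelicot Require Import Coquelicot.
Open Scope R_scope.

Definition strip (b : R) (z : C) : Prop := Rabs (Im z) < b.

Definition holo_on (U : C -> Prop) (f : C -> C) : Prop :=
  forall z, U z -> exists l : C, forall eps : R, 0 < eps ->
    exists delta : R, 0 < delta /\
      forall w, U w -> 0 < Cmod ((w - z)%C) < delta ->
        Cmod (((f w - f z) / (w - z) - l)%C) < eps.

Definition cyl_eq (z w : C) : Prop := exists k : Z, Cminus z w = RtoC (IZR k).

(* Lift Phi : B(b) -> C of a conformal embedding phi : B(b)/Z -> C/Z with
   phi_*(1) = 1 on fundamental groups, i.e. Phi is holomorphic, satisfies
   Phi(z+1) = Phi(z) + 1, and induces an injective map on the quotients. *)
Definition lift_of_conformal_embedding (b : R) (Phi : C -> C) : Prop :=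
  holo_on (strip b) Phi /\
  (forall z, strip b z -> Phi (z + 1)%C = (Phi z + 1)%C) /\
  (forall z w, strip b z -> strip b w -> cyl_eq (Phi z) (Phi w) -> cyl_eq z w).

(* Euclidean distance in C/Z between the classes of z and w is at most eps
   (the infimum over integer translates is attained). *)
Definition cyl_dist_le (z w : C) (eps : R) : Prop :=
  exists k : Z, Cmod ((z - w - RtoC (IZR k))%C) <= eps.

(* Main.v *)
(* On a disc of radius 1/4 around a point at distance at least 1 from the boundary, a lift Phi
   never takes two values differing by 1, so Bloch's argument bounds Phi' there by a universal constant.
   Hence h(z) = Phi(z) - z is 1-periodic with bounded derivative on |Im z| <= b - 1.
   For real s in [0,1] the difference h(z+s) - h(z) is bounded by sup |h'|, so a Cauchy estimate
   on a large disc makes h' almost constant along a period; as h' has mean 0 over a period, its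
   supremum halves each time the strip is narrowed by a fixed width.  Summing the resulting
   geometric series along a vertical path gives |h(z) - h(0)| <= eps once |Im z| <= b - c.

   Holomorphy here does not include continuity of the derivative, so the Cauchy estimate is
   derived from Goursat's lemma on rectangles: comparing (f(w) - f(a)) / (w - a)^2 with
   f'(a) / (w - a) on small squares around a bounds f'(a). *)

Require Import Defs.
From Stdlib Require Import Reals ZArith Lra Lia Classical IndefiniteDescription.
From Coquelicot Require Import Coquelicot.
Open Scope R_scope.

(** * Coordinates and triangle inequalities for the modulus *)

Lemma Cmod_le_Rabs_plus (z : C) : Cmod z <= Rabs (fst z) + Rabs (snd z).
Proof.
  replace z with (RtoC (fst z) + Ci * RtoC (snd z))%C at 1
    by (apply injective_projections; simpl; ring).
  eapply Rle_trans; [apply Cmod_triangle|].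
  rewrite Cmod_mult, Cmod_Ci, !Cmod_R; lra.
Qed.

Lemma Rabs_fst_le_Cmod (z : C) : Rabs (fst z) <= Cmod z.
Proof. eapply Rle_trans; [apply Rmax_l|apply Rmax_Cmod]. Qed.

Lemma Rabs_snd_le_Cmod (z : C) : Rabs (snd z) <= Cmod z.
Proof. eapply Rle_trans; [apply Rmax_r|apply Rmax_Cmod]. Qed.

Lemma Cmod_minus_sym (z w : C) : Cmod (z - w) = Cmod (w - z).
Proof. rewrite <- Cmod_opp; f_equal; ring. Qed.

Lemma Cmod_minus_triangle (z w v : C) : Cmod (z - v) <= Cmod (z - w) + Cmod (w - v).
Proof. replace (z - v)%C with ((z - w) + (w - v))%C by ring; apply Cmod_triangle. Qed.

Lemma Cmod_minus_diag (z : C) : Cmod (z - z) = 0.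
Proof. replace (z - z)%C with (RtoC 0) by ring; apply Cmod_0. Qed.

Lemma Cminus_neq_0 (z w : C) : z <> w -> (z - w)%C <> RtoC 0.
Proof. intros H; apply Cminus_eq_contra; exact H. Qed.

Lemma norm_C_R (z : C) : @norm _ C_R_NormedModule z = Cmod z.
Proof.
  unfold Cmod, norm; simpl; unfold prod_norm; f_equal.
  unfold norm; simpl; unfold abs; simpl; rewrite !Rmult_1_r, <- !Rabs_mult.
  now rewrite !Rabs_pos_eq by apply Rle_0_sqr.
Qed.

(** * Complex differentiability *)

(** The denominator of the difference quotient is cleared, so [w = z] needs no exclusion, and [w]
    ranges over a full disc instead of a disc cut down to a domain. *)
Definition cderiv (f : C -> C) (z l : C) : Prop :=
  forall eps : R, 0 < eps -> exists delta : R, 0 < delta /\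
    forall w, Cmod (w - z) < delta ->
      Cmod (f w - f z - l * (w - z)) <= eps * Cmod (w - z).

Definition ccont (f : C -> C) (z : C) : Prop :=
  forall eps : R, 0 < eps -> exists delta : R, 0 < delta /\
    forall w, Cmod (w - z) < delta -> Cmod (f w - f z) < eps.

Lemma cderiv_ccont (f : C -> C) (z l : C) : cderiv f z l -> ccont f z.
Proof.
  intros H eps He.
  destruct (H 1 Rlt_0_1) as [d [Hd Hf]].
  assert (Hl := Cmod_ge_0 l).
  assert (Hk : 0 < eps / (2 + Cmod l)) by (apply Rdiv_lt_0_compat; lra).
  exists (Rmin d (eps / (2 + Cmod l))); split; [apply Rmin_pos; assumption|].
  intros w Hw.
  assert (H1 := Rmin_l d (eps / (2 + Cmod l))).
  assert (H2 := Rmin_r d (eps / (2 + Cmod l))).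
  specialize (Hf w ltac:(lra)).
  assert (H3 : Cmod (f w - f z) <= (1 + Cmod l) * Cmod (w - z)).
  { replace (f w - f z)%C with ((f w - f z - l * (w - z)) + l * (w - z))%C by ring.
    eapply Rle_trans; [apply Cmod_triangle|].
    rewrite Cmod_mult; lra. }
  assert (H4 : (2 + Cmod l) * Cmod (w - z) < eps).
  { apply Rlt_le_trans with ((2 + Cmod l) * (eps / (2 + Cmod l))).
    - apply Rmult_lt_compat_l; lra.
    - right; field; lra. }
  assert (H5 := Cmod_ge_0 (w - z)); lra.
Qed.

Lemma cderiv_const (c z : C) : cderiv (fun _ => c) z 0.
Proof.
  intros eps He; exists 1; split; [lra|]; intros w _.
  replace (c - c - 0 * (w - z))%C with (RtoC 0) by ring.
  rewrite Cmod_0; apply Rmult_le_pos; [lra|apply Cmod_ge_0].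
Qed.

Lemma cderiv_id (z : C) : cderiv (fun w => w) z 1.
Proof.
  intros eps He; exists 1; split; [lra|]; intros w _.
  replace (w - z - 1 * (w - z))%C with (RtoC 0) by ring.
  rewrite Cmod_0; apply Rmult_le_pos; [lra|apply Cmod_ge_0].
Qed.

Lemma cderiv_lin (f g : C -> C) (c z l m : C) :
  cderiv f z l -> cderiv g z m -> cderiv (fun w => f w + c * g w)%C z (l + c * m).
Proof.
  intros Hf Hg eps He.
  assert (Hc := Cmod_ge_0 c).
  destruct (Hf (eps / 2) ltac:(lra)) as [d1 [Hd1 H1]].
  destruct (Hg (eps / (2 * (1 + Cmod c)))) as [d2 [Hd2 H2]].
  { apply Rdiv_lt_0_compat; lra. }
  exists (Rmin d1 d2); split; [apply Rmin_pos; assumption|]; intros w Hw.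
  assert (A1 := Rmin_l d1 d2); assert (A2 := Rmin_r d1 d2).
  specialize (H1 w ltac:(lra)); specialize (H2 w ltac:(lra)).
  replace (f w + c * g w - (f z + c * g z) - (l + c * m) * (w - z))%C
    with ((f w - f z - l * (w - z)) + c * (g w - g z - m * (w - z)))%C by ring.
  eapply Rle_trans; [apply Cmod_triangle|]; rewrite Cmod_mult.
  assert (H3 : Cmod c * Cmod (g w - g z - m * (w - z)) <= eps / 2 * Cmod (w - z)).
  { apply Rle_trans with ((1 + Cmod c) * (eps / (2 * (1 + Cmod c)) * Cmod (w - z))).
    - apply Rmult_le_compat; try apply Cmod_ge_0; lra.
    - right; field; lra. }
  lra.
Qed.

Lemma cderiv_ext (f g : C -> C) (z l : C) :
  (forall w, f w = g w) -> cderiv f z l -> cderiv g z l.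
Proof.
  intros E H eps He; destruct (H eps He) as [d [Hd Hf]]; exists d; split; [exact Hd|].
  intros w Hw; rewrite <- !E; auto.
Qed.

Lemma cderiv_minus (f g : C -> C) (z l m : C) :
  cderiv f z l -> cderiv g z m -> cderiv (fun w => f w - g w)%C z (l - m).
Proof.
  intros Hf Hg; replace (l - m)%C with (l + - (1) * m)%C by ring.
  apply cderiv_ext with (fun w => f w + - (1) * g w)%C; [intros; ring|].
  now apply cderiv_lin.
Qed.

Lemma cderiv_shift (f : C -> C) (c z l : C) :
  cderiv f (z + c) l -> cderiv (fun w => f (w + c)%C) z l.
Proof.
  intros H eps He; destruct (H eps He) as [d [Hd Hf]]; exists d; split; [exact Hd|].
  intros w Hw; specialize (Hf (w + c)%C).
  replace (w + c - (z + c))%C with (w - z)%C in Hf by ring; auto.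
Qed.

Lemma cderiv_mult (f g : C -> C) (z l m : C) :
  cderiv f z l -> cderiv g z m -> cderiv (fun w => f w * g w)%C z (l * g z + f z * m).
Proof.
  intros Hf Hg eps He.
  assert (Hl := Cmod_ge_0 l).
  assert (Bf := Cmod_ge_0 (f z)); assert (Bg := Cmod_ge_0 (g z)).
  destruct (cderiv_ccont _ _ _ Hg (Rmin 1 (eps / (3 * (1 + Cmod l))))) as [d0 [Hd0 H0]].
  { apply Rmin_pos; [lra|apply Rdiv_lt_0_compat; lra]. }
  destruct (Hf (eps / (3 * (2 + Cmod (g z))))) as [d1 [Hd1 H1]].
  { apply Rdiv_lt_0_compat; lra. }
  destruct (Hg (eps / (3 * (1 + Cmod (f z))))) as [d2 [Hd2 H2]].
  { apply Rdiv_lt_0_compat; lra. }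
  exists (Rmin d0 (Rmin d1 d2)); split; [repeat apply Rmin_pos; assumption|]; intros w Hw.
  assert (A0 := Rmin_l d0 (Rmin d1 d2)); assert (A := Rmin_r d0 (Rmin d1 d2)).
  assert (A1 := Rmin_l d1 d2); assert (A2 := Rmin_r d1 d2).
  specialize (H0 w ltac:(lra)); specialize (H1 w ltac:(lra)); specialize (H2 w ltac:(lra)).
  assert (B1 := Rmin_l 1 (eps / (3 * (1 + Cmod l)))).
  assert (B2 := Rmin_r 1 (eps / (3 * (1 + Cmod l)))).
  (* Each of the three terms of this splitting gets a third of [eps]; the three radii were chosen
     accordingly, and every [1 +] or [2 +] in them avoids a zero denominator. *)
  replace (f w * g w - f z * g z - (l * g z + f z * m) * (w - z))%C
    with ((f w - f z - l * (w - z)) * g w + (f z * (g w - g z - m * (w - z))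
          + l * (g w - g z) * (w - z)))%C by ring.
  assert (Hgw : Cmod (g w) <= 1 + Cmod (g z)).
  { replace (g w) with ((g w - g z) + g z)%C by ring.
    eapply Rle_trans; [apply Cmod_triangle|]; lra. }
  eapply Rle_trans; [apply Cmod_triangle|].
  eapply Rle_trans; [apply Rplus_le_compat_l, Cmod_triangle|]; rewrite !Cmod_mult.
  assert (W := Cmod_ge_0 (w - z)).
  assert (C1 : Cmod (f w - f z - l * (w - z)) * Cmod (g w) <= eps / 3 * Cmod (w - z)).
  { apply Rle_trans with (eps / (3 * (2 + Cmod (g z))) * Cmod (w - z) * (2 + Cmod (g z))).
    - apply Rmult_le_compat; try apply Cmod_ge_0; lra.
    - right; field; lra. }
  assert (C2 : Cmod (f z) * Cmod (g w - g z - m * (w - z)) <= eps / 3 * Cmod (w - z)).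
  { apply Rle_trans with ((1 + Cmod (f z)) * (eps / (3 * (1 + Cmod (f z))) * Cmod (w - z))).
    - apply Rmult_le_compat; try apply Cmod_ge_0; lra.
    - right; field; lra. }
  assert (C3 : Cmod l * Cmod (g w - g z) * Cmod (w - z) <= eps / 3 * Cmod (w - z)).
  { apply Rmult_le_compat_r; [exact W|].
    apply Rle_trans with ((1 + Cmod l) * (eps / (3 * (1 + Cmod l)))).
    - apply Rmult_le_compat; try apply Cmod_ge_0; lra.
    - right; field; lra. }
  lra.
Qed.

Lemma cderiv_inv_shift (a z : C) :
  z <> a -> cderiv (fun w => / (w - a))%C z (- / ((z - a) * (z - a))).
Proof.
  intros Hz eps He.
  assert (Hza := Cminus_neq_0 _ _ Hz).
  assert (Hr : 0 < Cmod (z - a)) by now apply Cmod_gt_0.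
  set (r := Cmod (z - a)) in *.
  assert (Hr3 : 0 < r * r * r) by (repeat apply Rmult_lt_0_compat; exact Hr).
  (* The remainder is [(w - z)^2 / ((w - a) (z - a)^2)]. The first bound keeps [w] at distance at
     least [r / 2] from [a], so that the remainder is at most [2 / r^3] times [|w - z|^2]; the
     second turns this into [eps * |w - z|]. *)
  exists (Rmin (r / 2) (eps * (r * r * r) / 2)); split.
  { apply Rmin_pos; [lra|]. assert (0 < eps * (r * r * r)) by (apply Rmult_lt_0_compat; lra). lra. }
  intros w Hw.
  assert (A1 := Rmin_l (r / 2) (eps * (r * r * r) / 2)).
  assert (A2 := Rmin_r (r / 2) (eps * (r * r * r) / 2)).
  assert (Hwa : r / 2 <= Cmod (w - a)).
  { assert (T := Cmod_minus_triangle z w a); rewrite Cmod_minus_sym in T.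
    rewrite (Cmod_minus_sym z w) in T; rewrite (Cmod_minus_sym a z) in T; fold r in T; lra. }
  assert (Hwa0 : (w - a)%C <> RtoC 0) by (apply Cmod_gt_0; lra).
  replace (/ (w - a) - / (z - a) - - / ((z - a) * (z - a)) * (w - z))%C
    with ((w - z) * ((w - z) * / ((w - a) * ((z - a) * (z - a)))))%C
    by (field; split; assumption).
  rewrite Cmod_mult, Rmult_comm; apply Rmult_le_compat_r; [apply Cmod_ge_0|].
  rewrite Cmod_mult, Cmod_inv by (repeat apply Cmult_neq_0; assumption).
  rewrite !Cmod_mult; fold r.
  apply Rle_trans with (eps * (r * r * r) / 2 * / (r / 2 * (r * r))).
  - apply Rmult_le_compat; [apply Cmod_ge_0| |lra|].
    + left; apply Rinv_0_lt_compat; repeat apply Rmult_lt_0_compat; lra.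
    + apply Rinv_le_contravar; [repeat apply Rmult_lt_0_compat; lra|].
      apply Rmult_le_compat_r; [nra|exact Hwa].
  - right; field; lra.
Qed.

(** * Bisection of rectangles *)

(** The supremum of the lower ends works, since monotonicity at index [n + m] puts each lower end
    below each upper one. *)
Lemma nested_intervals (lo hi : nat -> R) :
  (forall n, lo n <= lo (S n)) -> (forall n, hi (S n) <= hi n) ->
  (forall n, lo n <= hi n) -> exists x, forall n, lo n <= x <= hi n.
Proof.
  intros Hl Hh Hlh.
  assert (ML : forall n k, lo n <= lo (n + k)%nat).
  { intros n k; induction k; [rewrite Nat.add_0_r; lra|].
    rewrite Nat.add_succ_r; specialize (Hl (n + k)%nat); lra. }
  assert (MH : forall n k, hi (n + k)%nat <= hi n).
  { intros n k; induction k; [rewrite Nat.add_0_r; lra|].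
    rewrite Nat.add_succ_r; specialize (Hh (n + k)%nat); lra. }
  assert (LH : forall n m, lo n <= hi m).
  { intros n m; specialize (ML n m); specialize (MH m n); specialize (Hlh (n + m)%nat).
    rewrite Nat.add_comm in MH; lra. }
  destruct (completeness (fun y => exists n, y = lo n)) as [x [Hx1 Hx2]].
  - exists (hi 0%nat); intros y [n ->]; apply LH.
  - exists (lo 0%nat), 0%nat; reflexivity.
  - exists x; intros n; split; [apply Hx1; exists n; reflexivity|].
    apply Hx2; intros y [m ->]; apply LH.
Qed.

Record rect := Rect { x_lo : R; x_hi : R; y_lo : R; y_hi : R }.

(** The ordering of the ends of [q] is included, so [sub_rect r r] expresses that [r] is a genuine,
    possibly degenerate, rectangle. *)
Definition sub_rect (q r : rect) : Prop :=
  x_lo r <= x_lo q /\ x_lo q <= x_hi q /\ x_hi q <= x_hi r /\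
  y_lo r <= y_lo q /\ y_lo q <= y_hi q /\ y_hi q <= y_hi r.

Definition in_rect (r : rect) (z : C) : Prop :=
  x_lo r <= fst z <= x_hi r /\ y_lo r <= snd z <= y_hi r.

Definition semiperim (r : rect) : R := (x_hi r - x_lo r) + (y_hi r - y_lo r).

Definition half (a b : R) (up : bool) : R * R :=
  if up then ((a + b) / 2, b) else (a, (a + b) / 2).

Definition quarter (r : rect) (i j : bool) : rect :=
  Rect (fst (half (x_lo r) (x_hi r) i)) (snd (half (x_lo r) (x_hi r) i))
       (fst (half (y_lo r) (y_hi r) j)) (snd (half (y_lo r) (y_hi r) j)).

Lemma quarter_spec (r : rect) (i j : bool) :
  sub_rect r r -> sub_rect (quarter r i j) r /\ semiperim (quarter r i j) = semiperim r / 2.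
Proof.
  unfold sub_rect, semiperim, quarter; destruct i, j; simpl; lra.
Qed.

Lemma in_rect_sub (q r : rect) (z : C) : sub_rect q r -> in_rect q z -> in_rect r z.
Proof. unfold sub_rect, in_rect; lra. Qed.

Lemma sub_rect_trans (p q r : rect) : sub_rect p q -> sub_rect q r -> sub_rect p r.
Proof. unfold sub_rect; lra. Qed.

Lemma sub_rect_refl_l (q r : rect) : sub_rect q r -> sub_rect q q.
Proof. unfold sub_rect; lra. Qed.

Lemma pow_half_small (K eps : R) : 0 < eps -> exists n : nat, K * (/ 2) ^ n < eps.
Proof.
  intros He.
  assert (HK : 0 < Rabs K + 1) by (assert (H := Rabs_pos K); lra).
  destruct (pow_lt_1_zero (/ 2)) with (y := eps / (Rabs K + 1)) as [n Hn].
  - rewrite Rabs_pos_eq; lra.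
  - apply Rdiv_lt_0_compat; lra.
  - exists n; specialize (Hn n (Nat.le_refl n)).
    assert (Hp : 0 < (/ 2) ^ n) by (apply pow_lt; lra).
    rewrite Rabs_pos_eq in Hn by lra.
    apply Rle_lt_trans with ((Rabs K + 1) * (/ 2) ^ n).
    + apply Rmult_le_compat_r; [lra|]; assert (H := Rle_abs K); lra.
    + apply Rlt_le_trans with ((Rabs K + 1) * (eps / (Rabs K + 1))).
      * apply Rmult_lt_compat_l; lra.
      * right; field; lra.
Qed.

(* Cousin's lemma for quartering: unlike a Lebesgue number, it provides small
   rectangles containing the point at which the local property is invoked. *)
Lemma rect_bisection (P : rect -> Prop) (r : rect) :
  sub_rect r r ->
  (forall q, sub_rect q r -> (forall i j, P (quarter q i j)) -> P q) ->
  (forall z, in_rect r z -> exists d, 0 < d /\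
     forall q, sub_rect q r -> in_rect q z -> semiperim q < d -> P q) ->
  P r.
Proof.
  intros Hr Hquart Hloc; apply NNPP; intros Hbad.
  (* [next] sends a bad subrectangle to one of its bad quarters; every other rectangle is sent to
     itself as a default. *)
  destruct (functional_choice (fun q q' : rect => sub_rect q r -> ~ P q ->
     exists i j, q' = quarter q i j /\ ~ P q')) as [next Hnext].
  { intros q; destruct (classic (sub_rect q r /\ ~ P q)) as [[Hq1 Hq2]|Hn].
    - destruct (classic (exists i j, ~ P (quarter q i j))) as [[i [j Hij]]|Hn].
      + exists (quarter q i j); intros _ _; exists i, j; auto.
      + exfalso; apply Hq2, Hquart; [exact Hq1|].
        intros i j; apply NNPP; intros Hij; apply Hn; exists i, j; exact Hij.
    - exists q; intros A B; exfalso; auto. }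
  set (u := fun n => Nat.iter n next r).
  assert (Hu : forall n, sub_rect (u n) r /\ ~ P (u n) /\ semiperim (u n) = semiperim r * (/ 2) ^ n).
  { induction n as [|n [IH1 [IH2 IH3]]]; [simpl; repeat split; try assumption; try apply Hr; lra|].
    destruct (Hnext (u n) IH1 IH2) as [i [j [E Hn]]].
    destruct (quarter_spec (u n) i j (sub_rect_refl_l _ _ IH1)) as [Q1 Q2].
    change (u (S n)) with (next (u n)); rewrite E in *.
    split; [eapply sub_rect_trans; eassumption|split; [exact Hn|]].
    rewrite Q2, IH3; simpl; field. }
  assert (Hs : forall n, sub_rect (u (S n)) (u n)).
  { intros n; destruct (Hu n) as [IH1 [IH2 _]].
    destruct (Hnext (u n) IH1 IH2) as [i [j [E _]]].
    change (u (S n)) with (next (u n)); rewrite E.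
    apply quarter_spec; eapply sub_rect_refl_l; exact IH1. }
  assert (Hv : forall n, sub_rect (u n) (u n)).
  { intros n; eapply sub_rect_refl_l; apply Hu. }
  destruct (nested_intervals (fun n => x_lo (u n)) (fun n => x_hi (u n))) as [x Hx];
    try (intros n; specialize (Hs n); specialize (Hv n); unfold sub_rect in Hs, Hv; lra).
  destruct (nested_intervals (fun n => y_lo (u n)) (fun n => y_hi (u n))) as [y Hy];
    try (intros n; specialize (Hs n); specialize (Hv n); unfold sub_rect in Hs, Hv; lra).
  (* The iterates shrink to [(x, y)]. Once their semiperimeter is below the [d] of that point, the
     local property contradicts their badness. *)
  destruct (Hloc (x, y)) as [d [Hd Hdp]].
  { apply (in_rect_sub (u 0%nat)); [exact Hr|]; split; simpl; [apply (Hx 0%nat)|apply (Hy 0%nat)]. }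
  destruct (pow_half_small (semiperim r) d Hd) as [n Hn].
  destruct (Hu n) as [U1 [U2 U3]].
  apply U2, Hdp; [exact U1|split; simpl; auto|lra].
Qed.

Lemma in_rect_dist (r : rect) (z w : C) :
  in_rect r z -> in_rect r w -> Cmod (w - z) <= semiperim r.
Proof.
  intros [H1 H2] [H3 H4]; eapply Rle_trans; [apply Cmod_le_Rabs_plus|].
  unfold semiperim; apply Rplus_le_compat; apply Rabs_le; simpl; lra.
Qed.

(** Bisection replaces compactness: four bounds on the quarters combine by their maximum, and near
    [z] continuity gives the bound [Cmod (f z) + 1]. *)
Lemma ccont_bounded_on_rect (f : C -> C) (r : rect) :
  sub_rect r r -> (forall z, in_rect r z -> ccont f z) ->
  exists M, forall z, in_rect r z -> Cmod (f z) <= M.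
Proof.
  intros Hr Hf.
  apply (rect_bisection (fun q => exists M, forall z, in_rect q z -> Cmod (f z) <= M) r Hr).
  - intros q _ Hq.
    destruct (Hq true true) as [M1 H1]; destruct (Hq true false) as [M2 H2].
    destruct (Hq false true) as [M3 H3]; destruct (Hq false false) as [M4 H4].
    exists (Rmax (Rmax M1 M2) (Rmax M3 M4)); intros z [Hx Hy].
    assert (A := Rmax_l M1 M2); assert (A' := Rmax_r M1 M2).
    assert (B := Rmax_l M3 M4); assert (B' := Rmax_r M3 M4).
    assert (D := Rmax_l (Rmax M1 M2) (Rmax M3 M4)); assert (D' := Rmax_r (Rmax M1 M2) (Rmax M3 M4)).
    destruct (Rle_dec (fst z) ((x_lo q + x_hi q) / 2)); destruct (Rle_dec (snd z) ((y_lo q + y_hi q) / 2)).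
    + specialize (H4 z); unfold in_rect, quarter in H4; simpl in H4; lra.
    + specialize (H3 z); unfold in_rect, quarter in H3; simpl in H3; lra.
    + specialize (H2 z); unfold in_rect, quarter in H2; simpl in H2; lra.
    + specialize (H1 z); unfold in_rect, quarter in H1; simpl in H1; lra.
  - intros z Hz; destruct (Hf z Hz 1 Rlt_0_1) as [d [Hd Hfd]].
    exists d; split; [exact Hd|]; intros q Hq Hqz Hs; exists (Cmod (f z) + 1); intros w Hw.
    assert (T := in_rect_dist q z w Hqz Hw).
    specialize (Hfd w ltac:(lra)).
    replace (f w) with (f z + (f w - f z))%C by ring.
    eapply Rle_trans; [apply Cmod_triangle|]; lra.
Qed.

(** * Contour integrals over rectangles *)

Definition hint (F : C -> C) (y a b : R) : C :=
  RInt (V := C_R_CompleteNormedModule) (fun t => F (t, y)) a b.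

Definition vint (F : C -> C) (x a b : R) : C :=
  RInt (V := C_R_CompleteNormedModule) (fun t => F (x, t)) a b.

(** The counterclockwise contour integral of [F dz]: bottom, right, top, left. The vertical sides
    carry [dz = i dt]; the top and left sides are run backwards. *)
Definition rint (F : C -> C) (r : rect) : C :=
  (hint F (y_lo r) (x_lo r) (x_hi r) + Ci * vint F (x_hi r) (y_lo r) (y_hi r)
   - hint F (y_hi r) (x_lo r) (x_hi r) - Ci * vint F (x_lo r) (y_lo r) (y_hi r))%C.

Definition on_boundary (r : rect) (z : C) : Prop :=
  in_rect r z /\ (fst z = x_lo r \/ fst z = x_hi r \/ snd z = y_lo r \/ snd z = y_hi r).

Lemma continuous_path (F : C -> C) (g : R -> C) (t : R) :
  (forall s, Cmod (g s - g t) <= Rabs (s - t)) -> ccont F (g t) ->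
  continuous (U := C_R_CompleteNormedModule) (fun s => F (g s)) t.
Proof.
  intros Hg HF; apply filterlim_locally; intros eps.
  destruct (HF eps (cond_pos eps)) as [d [Hd H]].
  exists (mkposreal d Hd); intros s Hs.
  assert (Hsd : Rabs (s - t) < d) by exact Hs.
  specialize (H (g s)); assert (G := Hg s); specialize (H ltac:(lra)).
  split; eapply Rle_lt_trans; [|exact H| |exact H].
  - exact (Rabs_fst_le_Cmod (F (g s) - F (g t))%C).
  - exact (Rabs_snd_le_Cmod (F (g s) - F (g t))%C).
Qed.

Lemma ex_hint (F : C -> C) (y a b : R) :
  a <= b -> (forall t, a <= t <= b -> ccont F (t, y)) ->
  ex_RInt (V := C_R_CompleteNormedModule) (fun t => F (t, y)) a b.
Proof.
  intros Hab H; apply ex_RInt_continuous; intros t; rewrite Rmin_left, Rmax_right by exact Hab; intros Ht.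
  apply (continuous_path F (fun s => (s, y)) t); [|auto].
  intros s; eapply Rle_trans; [apply Cmod_le_Rabs_plus|]; simpl.
  replace (y + - y) with 0 by ring; rewrite Rabs_R0; unfold Rminus; lra.
Qed.

Lemma ex_vint (F : C -> C) (x a b : R) :
  a <= b -> (forall t, a <= t <= b -> ccont F (x, t)) ->
  ex_RInt (V := C_R_CompleteNormedModule) (fun t => F (x, t)) a b.
Proof.
  intros Hab H; apply ex_RInt_continuous; intros t; rewrite Rmin_left, Rmax_right by exact Hab; intros Ht.
  apply (continuous_path F (fun s => (x, s)) t); [|auto].
  intros s; eapply Rle_trans; [apply Cmod_le_Rabs_plus|]; simpl.
  replace (x + - x) with 0 by ring; rewrite Rabs_R0; unfold Rminus; lra.
Qed.

Lemma hint_Chasles (F : C -> C) (y a b c : R) :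
  a <= b <= c -> (forall t, a <= t <= c -> ccont F (t, y)) ->
  hint F y a c = (hint F y a b + hint F y b c)%C.
Proof.
  intros Habc H; symmetry; unfold hint.
  apply (RInt_Chasles (V := C_R_CompleteNormedModule)); apply ex_hint; try lra; intros; apply H; lra.
Qed.

Lemma vint_Chasles (F : C -> C) (x a b c : R) :
  a <= b <= c -> (forall t, a <= t <= c -> ccont F (x, t)) ->
  vint F x a c = (vint F x a b + vint F x b c)%C.
Proof.
  intros Habc H; symmetry; unfold vint.
  apply (RInt_Chasles (V := C_R_CompleteNormedModule)); apply ex_vint; try lra; intros; apply H; lra.
Qed.

Lemma rint_split_x (F : C -> C) (x1 x2 x3 y1 y2 : R) :
  x1 <= x2 <= x3 ->
  (forall t, x1 <= t <= x3 -> ccont F (t, y1)) -> (forall t, x1 <= t <= x3 -> ccont F (t, y2)) ->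
  rint F (Rect x1 x3 y1 y2) = (rint F (Rect x1 x2 y1 y2) + rint F (Rect x2 x3 y1 y2))%C.
Proof.
  intros Hx H1 H2; unfold rint; simpl.
  rewrite (hint_Chasles F y1 x1 x2 x3), (hint_Chasles F y2 x1 x2 x3) by assumption; ring.
Qed.

Lemma rint_split_y (F : C -> C) (x1 x2 y1 y2 y3 : R) :
  y1 <= y2 <= y3 ->
  (forall t, y1 <= t <= y3 -> ccont F (x1, t)) -> (forall t, y1 <= t <= y3 -> ccont F (x2, t)) ->
  rint F (Rect x1 x2 y1 y3) = (rint F (Rect x1 x2 y1 y2) + rint F (Rect x1 x2 y2 y3))%C.
Proof.
  intros Hy H1 H2; unfold rint; simpl.
  rewrite (vint_Chasles F x1 y1 y2 y3), (vint_Chasles F x2 y1 y2 y3) by assumption; ring.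
Qed.

Lemma boundary_points (r : rect) (P : C -> Prop) :
  sub_rect r r -> (forall z, on_boundary r z -> P z) ->
  (forall t, x_lo r <= t <= x_hi r -> P (t, y_lo r)) /\ (forall t, x_lo r <= t <= x_hi r -> P (t, y_hi r)) /\
  (forall t, y_lo r <= t <= y_hi r -> P (x_lo r, t)) /\ (forall t, y_lo r <= t <= y_hi r -> P (x_hi r, t)).
Proof.
  unfold sub_rect, on_boundary, in_rect; intros Hr H; repeat split; intros t Ht; apply H; simpl; tauto || lra.
Qed.

(** The boundary has length [2 * semiperim r]. The bound is put on a difference because both uses
    with a nonzero [G] compare a function with a model whose integral is understood. *)
Lemma rint_minus_bound (F G : C -> C) (r : rect) (M : R) :
  sub_rect r r ->
  (forall z, on_boundary r z -> ccont F z) -> (forall z, on_boundary r z -> ccont G z) ->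
  (forall z, on_boundary r z -> Cmod (F z - G z) <= M) ->
  Cmod (rint F r - rint G r) <= 2 * semiperim r * M.
Proof.
  intros Hr HF HG HM.
  destruct (boundary_points r _ Hr HF) as [F1 [F2 [F3 F4]]].
  destruct (boundary_points r _ Hr HG) as [G1 [G2 [G3 G4]]].
  destruct (boundary_points r _ Hr HM) as [M1 [M2 [M3 M4]]].
  assert (Hh : forall y, (forall t, x_lo r <= t <= x_hi r -> ccont F (t, y)) ->
    (forall t, x_lo r <= t <= x_hi r -> ccont G (t, y)) ->
    (forall t, x_lo r <= t <= x_hi r -> Cmod (F (t, y) - G (t, y)) <= M) ->
    Cmod (hint F y (x_lo r) (x_hi r) - hint G y (x_lo r) (x_hi r)) <= (x_hi r - x_lo r) * M).
  { intros y A B D; rewrite <- norm_C_R.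
    eapply (norm_RInt_le_const (V := C_R_NormedModule) (fun t => minus (F (t, y)) (G (t, y))) (x_lo r) (x_hi r));
      [unfold sub_rect in Hr; lra| |].
    - intros t Ht; eapply Rle_trans; [right; apply norm_C_R|]; exact (D t Ht).
    - apply (is_RInt_minus (V := C_R_NormedModule));
        apply (RInt_correct (V := C_R_CompleteNormedModule)); apply ex_hint; auto;
        unfold sub_rect in Hr; lra. }
  assert (Hv : forall x, (forall t, y_lo r <= t <= y_hi r -> ccont F (x, t)) ->
    (forall t, y_lo r <= t <= y_hi r -> ccont G (x, t)) ->
    (forall t, y_lo r <= t <= y_hi r -> Cmod (F (x, t) - G (x, t)) <= M) ->
    Cmod (vint F x (y_lo r) (y_hi r) - vint G x (y_lo r) (y_hi r)) <= (y_hi r - y_lo r) * M).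
  { intros x A B D; rewrite <- norm_C_R.
    eapply (norm_RInt_le_const (V := C_R_NormedModule) (fun t => minus (F (x, t)) (G (x, t))) (y_lo r) (y_hi r));
      [unfold sub_rect in Hr; lra| |].
    - intros t Ht; eapply Rle_trans; [right; apply norm_C_R|]; exact (D t Ht).
    - apply (is_RInt_minus (V := C_R_NormedModule));
        apply (RInt_correct (V := C_R_CompleteNormedModule)); apply ex_vint; auto;
        unfold sub_rect in Hr; lra. }
  specialize (Hh (y_lo r) F1 G1 M1) as HH1; specialize (Hh (y_hi r) F2 G2 M2) as HH2.
  specialize (Hv (x_lo r) F3 G3 M3) as HV1; specialize (Hv (x_hi r) F4 G4 M4) as HV2.
  unfold rint.
  set (f1 := hint F (y_lo r) _ _) in *; set (f2 := hint F (y_hi r) _ _) in *.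
  set (f3 := vint F (x_lo r) _ _) in *; set (f4 := vint F (x_hi r) _ _) in *.
  set (g1 := hint G (y_lo r) _ _) in *; set (g2 := hint G (y_hi r) _ _) in *.
  set (g3 := vint G (x_lo r) _ _) in *; set (g4 := vint G (x_hi r) _ _) in *.
  replace (f1 + Ci * f4 - f2 - Ci * f3 - (g1 + Ci * g4 - g2 - Ci * g3))%C
    with ((f1 - g1) + (Ci * (f4 - g4) + (- (f2 - g2) + - (Ci * (f3 - g3)))))%C by ring.
  eapply Rle_trans; [apply Cmod_triangle|].
  eapply Rle_trans; [apply Rplus_le_compat_l, Cmod_triangle|].
  eapply Rle_trans; [apply Rplus_le_compat_l, Rplus_le_compat_l, Cmod_triangle|].
  rewrite !Cmod_opp, !Cmod_mult, Cmod_Ci; unfold semiperim; lra.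
Qed.

Lemma is_RInt_affine (p q a b : R) :
  is_RInt (fun t => p + q * t) a b (p * (b - a) + q * (b * b - a * a) / 2).
Proof.
  replace (p * (b - a) + q * (b * b - a * a) / 2)
    with (minus (p * b + q * (b * b) / 2) (p * a + q * (a * a) / 2))
    by (unfold minus, plus, opp; simpl; field).
  apply (is_RInt_derive (fun t => p * t + q * (t * t) / 2)).
  - intros x _; auto_derive; [exact I|field].
  - intros x _; apply (ex_derive_continuous (fun t => p + q * t)); auto_derive; exact I.
Qed.

Lemma hint_affine (u v : C) (y a b : R) :
  hint (fun w => u + v * w)%C y a b
  = ((u + v * (0, y)) * RtoC (b - a) + v * RtoC ((b * b - a * a) / 2))%C.
Proof.
  unfold hint; apply (is_RInt_unique (V := C_R_CompleteNormedModule)).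
  apply (is_RInt_fct_extend_pair (U := R_NormedModule) (V := R_NormedModule)); simpl.
  - apply is_RInt_ext with (fun t => (fst u - snd v * y) + fst v * t); [intros; simpl; ring|].
    eapply eq_ind; [apply is_RInt_affine|]; simpl; field.
  - apply is_RInt_ext with (fun t => (snd u + fst v * y) + snd v * t); [intros; simpl; ring|].
    eapply eq_ind; [apply is_RInt_affine|]; simpl; field.
Qed.

Lemma vint_affine (u v : C) (x a b : R) :
  vint (fun w => u + v * w)%C x a b
  = ((u + v * (x, 0)) * RtoC (b - a) + Ci * v * RtoC ((b * b - a * a) / 2))%C.
Proof.
  unfold vint; apply (is_RInt_unique (V := C_R_CompleteNormedModule)).
  apply (is_RInt_fct_extend_pair (U := R_NormedModule) (V := R_NormedModule)); simpl.
  - apply is_RInt_ext with (fun t => (fst u + fst v * x) + - snd v * t); [intros; simpl; ring|].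
    eapply eq_ind; [apply is_RInt_affine|]; simpl; field.
  - apply is_RInt_ext with (fun t => (snd u + snd v * x) + fst v * t); [intros; simpl; ring|].
    eapply eq_ind; [apply is_RInt_affine|]; simpl; field.
Qed.

(** Cauchy's theorem for affine functions by explicit integration; Goursat's argument compares a
    function with its tangent affine map. *)
Lemma rint_affine (u v : C) (r : rect) : rint (fun w => u + v * w)%C r = RtoC 0.
Proof.
  unfold rint; rewrite !hint_affine, !vint_affine; destruct u, v.
  apply injective_projections; simpl; field.
Qed.

Lemma rint_quarters (F : C -> C) (r : rect) :
  sub_rect r r -> (forall z, in_rect r z -> ccont F z) ->
  rint F r = (rint F (quarter r false false) + rint F (quarter r true false)
              + (rint F (quarter r false true) + rint F (quarter r true true)))%C.
Proof.
  destruct r as [x1 x2 y1 y2]; unfold sub_rect, in_rect, quarter; simpl; intros Hr HF.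
  rewrite (rint_split_y F x1 x2 y1 ((y1 + y2) / 2) y2);
    try lra; try (intros t Ht; apply HF; simpl; lra).
  rewrite (rint_split_x F x1 ((x1 + x2) / 2) x2 y1), (rint_split_x F x1 ((x1 + x2) / 2) x2 _ y2);
    try lra; try (intros t Ht; apply HF; simpl; lra).
  reflexivity.
Qed.

(** A bound by [eps] times the squared semiperimeter passes from the four quarters to the whole, as
    each quarter has a quarter of that square. Near a point it follows from differentiability, and
    [eps] is arbitrary. *)
Lemma goursat (F : C -> C) (r : rect) :
  sub_rect r r -> (forall z, in_rect r z -> exists l, cderiv F z l) -> rint F r = RtoC 0.
Proof.
  intros Hr HF.
  assert (HC : forall z, in_rect r z -> ccont F z).
  { intros z Hz; destruct (HF z Hz) as [l Hl]; eapply cderiv_ccont; exact Hl. }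
  assert (Hall : forall eps, 0 < eps -> Cmod (rint F r) <= eps * (semiperim r * semiperim r)).
  { intros eps He.
    apply (rect_bisection (fun q => Cmod (rint F q) <= eps * (semiperim q * semiperim q)) r Hr).
    - intros q Hq IH.
      assert (Hqq := sub_rect_refl_l _ _ Hq).
      rewrite rint_quarters;
        [|exact Hqq|intros z Hz; apply HC; eapply in_rect_sub; eassumption].
      assert (E : forall i j, semiperim (quarter q i j) = semiperim q / 2)
        by (intros; now apply quarter_spec).
      assert (I1 := IH true true); assert (I2 := IH true false).
      assert (I3 := IH false true); assert (I4 := IH false false).
      rewrite E in I1, I2, I3, I4.
      eapply Rle_trans; [apply Cmod_triangle|].
      eapply Rle_trans; [apply Rplus_le_compat; apply Cmod_triangle|]; lra.
    - intros p Hp; destruct (HF p Hp) as [l Hl].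
      (* The half compensates the factor 2 in the boundary length [2 * semiperim q]. *)
      destruct (Hl (eps / 2) ltac:(lra)) as [d [Hd Hfd]].
      exists d; split; [exact Hd|]; intros q Hq Hqp Hs.
      assert (Hqq := sub_rect_refl_l _ _ Hq).
      assert (HS : 0 <= semiperim q) by (unfold sub_rect in Hqq; unfold semiperim; lra).
      set (A := fun w => ((F p - l * p) + l * w)%C).
      assert (HA : forall z, cderiv A z (0 + l * 1)).
      { intros z; apply (cderiv_lin (fun _ => F p - l * p)%C (fun w => w));
          [apply cderiv_const|apply cderiv_id]. }
      replace (rint F q) with (rint F q - rint A q)%C
        by (unfold A; rewrite rint_affine; ring).
      replace (eps * (semiperim q * semiperim q))
        with (2 * semiperim q * (eps / 2 * semiperim q)) by field.
      apply rint_minus_bound; [exact Hqq| | |].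
      + intros z [Hz _]; apply HC; eapply in_rect_sub; eassumption.
      + intros z _; eapply cderiv_ccont; apply HA.
      + intros z [Hz _]; unfold A.
        assert (T := in_rect_dist q p z Hqp Hz).
        replace (F z - (F p - l * p + l * z))%C with (F z - F p - l * (z - p))%C by ring.
        eapply Rle_trans; [apply Hfd; lra|]; apply Rmult_le_compat_l; lra. }
  destruct (Ceq_dec (rint F r) (RtoC 0)) as [E|N]; [exact E|exfalso].
  apply Cmod_gt_0 in N.
  assert (Hs := Rle_0_sqr (semiperim r)); unfold Rsqr in Hs.
  (* With this [eps] the bound is at most half of [Cmod (rint F r)]. The added 1 keeps the
     denominator positive when the rectangle is a point. *)
  specialize (Hall (Cmod (rint F r) / (2 * (1 + semiperim r * semiperim r)))).
  assert (Hp : 0 < Cmod (rint F r) / (2 * (1 + semiperim r * semiperim r)))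
    by (apply Rdiv_lt_0_compat; lra).
  specialize (Hall Hp).
  assert (Cmod (rint F r) / (2 * (1 + semiperim r * semiperim r)) * (1 + semiperim r * semiperim r)
    = Cmod (rint F r) / 2) by (field; lra).
  nra.
Qed.

(** * Integrals around a puncture *)

Definition square (a : C) (s : R) : rect := Rect (fst a - s) (fst a + s) (snd a - s) (snd a + s).

(** The region between the squares is cut into four rectangles that avoid [a], and Goursat's lemma
    makes their integrals vanish. *)
Lemma rint_punctured_square (G : C -> C) (a : C) (s r : R) :
  0 < s <= r ->
  (forall z, in_rect (square a r) z -> z <> a -> exists l, cderiv G z l) ->
  rint G (square a r) = rint G (square a s).
Proof.
  destruct a as [a1 a2]; intros Hs HG; unfold square in *; simpl in *.
  assert (HC : forall x y, a1 - r <= x <= a1 + r -> a2 - r <= y <= a2 + r ->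
    (x <> a1 \/ y <> a2) -> exists l, cderiv G (x, y) l).
  { intros x y Hx Hy Hn; apply HG; [split; simpl; lra|]; intros E; injection E; lra. }
  assert (HC' : forall x y, a1 - r <= x <= a1 + r -> a2 - r <= y <= a2 + r ->
    (x <> a1 \/ y <> a2) -> ccont G (x, y)).
  { intros x y Hx Hy Hn; destruct (HC x y Hx Hy Hn) as [l Hl]; eapply cderiv_ccont; exact Hl. }
  rewrite (rint_split_y G _ _ _ (a2 - s)); [|lra|intros t Ht; apply HC'; lra..].
  rewrite (rint_split_y G _ _ (a2 - s) (a2 + s)); [|lra|intros t Ht; apply HC'; lra..].
  rewrite (rint_split_x G _ (a1 - s) _ (a2 - s) (a2 + s)); [|lra|intros t Ht; apply HC'; lra..].
  rewrite (rint_split_x G (a1 - s) (a1 + s) _ (a2 - s) (a2 + s)); [|lra|intros t Ht; apply HC'; lra..].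
  assert (Z : forall x1 x2 y1 y2, a1 - r <= x1 <= x2 -> x2 <= a1 + r -> a2 - r <= y1 <= y2 -> y2 <= a2 + r ->
    (x2 < a1 \/ a1 < x1 \/ y2 < a2 \/ a2 < y1) -> rint G (Rect x1 x2 y1 y2) = RtoC 0).
  { intros x1 x2 y1 y2 B1 B2 B3 B4 B5; apply goursat; [unfold sub_rect; simpl; lra|].
    intros [x y] [Hx Hy]; simpl in *; apply HC; lra. }
  (* In order: the pieces below, above, left and right of the inner square. *)
  rewrite (Z _ _ (a2 - r)), (Z _ _ (a2 + s)), (Z (a1 - r)), (Z (a1 + s)); try lra.
  ring.
Qed.

Lemma on_boundary_square (a z : C) (s : R) :
  0 < s -> on_boundary (square a s) z -> s <= Cmod (z - a) /\ in_rect (square a s) z.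
Proof.
  intros Hs [Hin Hb]; split; [|exact Hin]; unfold square in Hb; simpl in Hb.
  destruct Hb as [E|[E|[E|E]]].
  - eapply Rle_trans; [|apply Rabs_fst_le_Cmod]; simpl; rewrite E.
    replace (fst a - s + - fst a) with (- s) by ring; rewrite Rabs_Ropp, Rabs_pos_eq; lra.
  - eapply Rle_trans; [|apply Rabs_fst_le_Cmod]; simpl; rewrite E.
    replace (fst a + s + - fst a) with s by ring; rewrite Rabs_pos_eq; lra.
  - eapply Rle_trans; [|apply Rabs_snd_le_Cmod]; simpl; rewrite E.
    replace (snd a - s + - snd a) with (- s) by ring; rewrite Rabs_Ropp, Rabs_pos_eq; lra.
  - eapply Rle_trans; [|apply Rabs_snd_le_Cmod]; simpl; rewrite E.
    replace (snd a + s + - snd a) with s by ring; rewrite Rabs_pos_eq; lra.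
Qed.

Lemma square_valid (a : C) (s : R) : 0 < s -> sub_rect (square a s) (square a s).
Proof. unfold sub_rect, square; simpl; lra. Qed.

Lemma RInt_ge_const (f : R -> R) (a b m I : R) :
  a <= b -> is_RInt f a b I -> (forall t, a <= t <= b -> m <= f t) -> m * (b - a) <= I.
Proof.
  intros Hab HI Hm.
  replace (m * (b - a)) with (scal (b - a) m) by (unfold scal; simpl; unfold mult; simpl; ring).
  eapply is_RInt_le; [exact Hab|apply (is_RInt_const a b m)|exact HI|].
  intros; apply Hm; lra.
Qed.

(* The exact value is 2 pi i; each side contributes at least 1 to the imaginary part. *)
Lemma rint_inv_square (a : C) (s : R) :
  0 < s -> 4 <= Cmod (rint (fun w => / (w - a))%C (square a s)).
Proof.
  intros Hs; set (k := fun w : C => (/ (w - a))%C).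
  assert (HC : forall z, z <> a -> ccont k z).
  { intros z Hz; eapply cderiv_ccont; apply cderiv_inv_shift; exact Hz. }
  assert (Hh : forall y, y <> snd a -> is_RInt (V := C_R_CompleteNormedModule) (fun t => k (t, y)) (fst a - s) (fst a + s)
     (hint k y (fst a - s) (fst a + s))).
  { intros y Hy; apply (RInt_correct (V := C_R_CompleteNormedModule)), ex_hint; [lra|].
    intros t _; apply HC; intros E; apply Hy; rewrite <- E; reflexivity. }
  assert (Hv : forall x, x <> fst a -> is_RInt (V := C_R_CompleteNormedModule) (fun t => k (x, t)) (snd a - s) (snd a + s)
     (vint k x (snd a - s) (snd a + s))).
  { intros x Hx; apply (RInt_correct (V := C_R_CompleteNormedModule)), ex_vint; [lra|].
    intros t _; apply HC; intros E; apply Hx; rewrite <- E; reflexivity. }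
  (* Up to sign, the relevant component of [1 / (w - a)] on a side is [s / (u^2 + s^2)] with
     [|u| <= s], hence at least [1 / (2 s)]; a side has length [2 s]. *)
  assert (K : forall t c, - s <= t - c <= s -> / (2 * s) <= s / ((t - c) * (t - c) + s * s)).
  { intros t c Ht.
    assert (Hp : 0 < (t - c) * (t - c) + s * s).
    { assert (A := Rle_0_sqr (t - c)); unfold Rsqr in A.
      assert (0 < s * s) by (apply Rmult_lt_0_compat; lra); lra. }
    apply Rmult_le_reg_r with (2 * s * ((t - c) * (t - c) + s * s));
      [repeat apply Rmult_lt_0_compat; lra|].
    replace (/ (2 * s) * (2 * s * ((t - c) * (t - c) + s * s))) with ((t - c) * (t - c) + s * s) by (field; lra).
    replace (s / ((t - c) * (t - c) + s * s) * (2 * s * ((t - c) * (t - c) + s * s))) with (2 * s * s)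
      by (field; lra).
    assert (A : 0 <= (s - (t - c)) * (s + (t - c))) by (apply Rmult_le_pos; lra).
    lra. }
  assert (Hn : forall u v, u = s \/ u = - s \/ v = s \/ v = - s -> u * u + v * v <> 0).
  { intros u v Huv E; assert (A := Rle_0_sqr u); assert (B := Rle_0_sqr v); unfold Rsqr in A, B.
    assert (Hss : 0 < s * s) by (apply Rmult_lt_0_compat; lra).
    destruct Huv as [->|[->|[->| ->]]]; lra. }
  (* Because of the factor [Ci] on vertical sides, the imaginary part of the contour integral
     collects imaginary parts of horizontal integrals and real parts of vertical ones. *)
  assert (B1 := is_RInt_fct_extend_snd _ _ _ _ (Hh (snd a - s) ltac:(lra))).
  assert (B2 := is_RInt_fct_extend_snd _ _ _ _ (Hh (snd a + s) ltac:(lra))).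
  assert (B3 := is_RInt_fct_extend_fst _ _ _ _ (Hv (fst a - s) ltac:(lra))).
  assert (B4 := is_RInt_fct_extend_fst _ _ _ _ (Hv (fst a + s) ltac:(lra))).
  (* On the top and left sides the component is negative, which matches their reversed
     orientation. *)
  apply (is_RInt_opp (V := R_NormedModule)) in B2.
  apply (is_RInt_opp (V := R_NormedModule)) in B3.
  apply RInt_ge_const with (m := / (2 * s)) in B1; [|lra|intros t Ht; simpl; eapply Rle_trans;
    [apply (K t (fst a)); lra|right; field; apply Hn; lra]].
  apply RInt_ge_const with (m := / (2 * s)) in B2; [|lra|intros t Ht; unfold opp; simpl; eapply Rle_trans;
    [apply (K t (fst a)); lra|right; field; apply Hn; lra]].
  apply RInt_ge_const with (m := / (2 * s)) in B3; [|lra|intros t Ht; unfold opp; simpl; eapply Rle_trans;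
    [apply (K t (snd a)); lra|right; field; apply Hn; lra]].
  apply RInt_ge_const with (m := / (2 * s)) in B4; [|lra|intros t Ht; simpl; eapply Rle_trans;
    [apply (K t (snd a)); lra|right; field; apply Hn; lra]].
  eapply Rle_trans; [|apply Rabs_snd_le_Cmod].
  eapply Rle_trans; [|apply Rle_abs].
  unfold rint, square; simpl.
  assert (E1 : / (2 * s) * (fst a + s - (fst a - s)) = 1) by (field; lra).
  assert (E2 : / (2 * s) * (snd a + s - (snd a - s)) = 1) by (field; lra).
  rewrite ?E1, ?E2 in *; unfold opp in *; simpl in *.
  lra.
Qed.

Lemma rint_bound (F : C -> C) (r : rect) (M : R) :
  sub_rect r r -> (forall z, on_boundary r z -> ccont F z) ->
  (forall z, on_boundary r z -> Cmod (F z) <= M) ->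
  Cmod (rint F r) <= 2 * semiperim r * M.
Proof.
  intros Hr HF HM.
  (* Zero is written as an affine function so that its integral is known to vanish. *)
  replace (rint F r) with (rint F r - rint (fun w => 0 + 0 * w)%C r)%C
    by (rewrite rint_affine; ring).
  apply rint_minus_bound; [exact Hr|exact HF| |].
  - intros z _; eapply cderiv_ccont.
    apply (cderiv_lin (fun _ => RtoC 0) (fun w => w)); [apply cderiv_const|apply cderiv_id].
  - intros z Hz; replace (F z - (0 + 0 * z))%C with (F z) by ring; auto.
Qed.

Lemma in_square_dist (a z : C) (s : R) : in_rect (square a s) z -> Cmod (z - a) <= 2 * s.
Proof.
  unfold in_rect, square; simpl; intros [H1 H2].
  eapply Rle_trans; [apply Cmod_le_Rabs_plus|]; simpl.
  assert (Rabs (fst z + - fst a) <= s) by (apply Rabs_le; lra).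
  assert (Rabs (snd z + - snd a) <= s) by (apply Rabs_le; lra).
  lra.
Qed.

Lemma in_square_of_dist (a z : C) (s : R) : Cmod (z - a) <= s -> in_rect (square a s) z.
Proof.
  intros H.
  assert (H1 := Rabs_fst_le_Cmod (z - a)); assert (H2 := Rabs_snd_le_Cmod (z - a)).
  simpl in H1, H2; unfold in_rect, square; simpl.
  assert (H3 : Rabs (fst z + - fst a) <= s) by lra; apply Rabs_le_between in H3.
  assert (H4 : Rabs (snd z + - snd a) <= s) by lra; apply Rabs_le_between in H4.
  lra.
Qed.

(** * The Cauchy estimate *)

Lemma cauchy_estimate (f : C -> C) (a l : C) (r M : R) :
  0 < r -> (forall w, Cmod (w - a) < r -> exists m, cderiv f w m) ->
  (forall w, Cmod (w - a) < r -> Cmod (f w - f a) <= M) ->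
  cderiv f a l -> Cmod l <= 6 * M / r.
Proof.
  intros Hr Hf HM Hl.
  assert (HM0 : 0 <= M).
  { specialize (HM a); rewrite Cmod_minus_diag in HM; specialize (HM Hr).
    rewrite Cmod_minus_diag in HM; exact HM. }
  destruct (Ceq_dec l (RtoC 0)) as [->|Hl0].
  { rewrite Cmod_0; apply Rmult_le_pos; [lra|left; apply Rinv_0_lt_compat; lra]. }
  assert (HL : 0 < Cmod l) by now apply Cmod_gt_0.
  (* Points of the square of half-side [q] are within [2 * q < r] of [a]. *)
  set (q := r / 3); assert (Hq : 0 < q) by (unfold q; lra).
  (* Dividing by [l] makes [1 / (w - a)] the model of [G] near [a]. The integral of the model has
     modulus at least 4, whereas that of [G] over the large square is controlled by [M]. *)
  set (G := fun w => (((f w - f a) * / l) * (/ (w - a) * / (w - a)))%C).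
  assert (HG : forall w, w <> a -> Cmod (w - a) < r -> exists m, cderiv G w m).
  { intros w Hw Hd; destruct (Hf w Hd) as [m Hm]; eexists; unfold G.
    apply (cderiv_mult (fun w => (f w - f a) * / l)%C (fun w => / (w - a) * / (w - a))%C).
    - apply (cderiv_mult (fun w => f w - f a)%C (fun _ => / l)%C); [|apply cderiv_const].
      apply (cderiv_minus f (fun _ => f a)); [exact Hm|apply cderiv_const].
    - apply (cderiv_mult (fun w => / (w - a))%C (fun w => / (w - a))%C);
        apply cderiv_inv_shift; exact Hw. }
  assert (HB : forall s, 0 < s <= q -> forall z, on_boundary (square a s) z ->
    s <= Cmod (z - a) <= 2 * s /\ z <> a /\ Cmod (z - a) < r).
  { intros s Hs z Hz; destruct (on_boundary_square a z s ltac:(lra) Hz) as [B1 B2].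
    apply in_square_dist in B2; repeat split; try lra.
    - intros ->; rewrite Cmod_minus_diag in B1; lra.
    - unfold q in Hs; lra. }
  assert (HGc : forall s, 0 < s <= q -> forall z, on_boundary (square a s) z -> ccont G z).
  { intros s Hs z Hz; destruct (HB s Hs z Hz) as [_ [N D]].
    destruct (HG z N D) as [m Hm]; eapply cderiv_ccont; exact Hm. }
  assert (Hout : Cmod (rint G (square a q)) <= 8 * M / (q * Cmod l)).
  { replace (8 * M / (q * Cmod l)) with (2 * semiperim (square a q) * (M / (q * q * Cmod l)))
      by (unfold semiperim, square; simpl; field; lra).
    apply rint_bound; [apply square_valid; exact Hq|apply HGc; lra|].
    intros z Hz; destruct (HB q ltac:(lra) z Hz) as [[B1 _] [N D]].
    assert (Hne := Cminus_neq_0 _ _ N).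
    unfold G; rewrite !Cmod_mult, !Cmod_inv by assumption.
    replace (M / (q * q * Cmod l)) with ((M * / Cmod l) * (/ q * / q)) by (field; lra).
    assert (I : / Cmod (z - a) <= / q) by (apply Rinv_le_contravar; lra).
    assert (I0 : 0 < / Cmod (z - a)) by (apply Rinv_0_lt_compat; lra).
    assert (I1 : 0 < / Cmod l) by (apply Rinv_0_lt_compat; lra).
    apply Rmult_le_compat.
    - apply Rmult_le_pos; [apply Cmod_ge_0|lra].
    - apply Rmult_le_pos; lra.
    - apply Rmult_le_compat_r; [lra|auto].
    - apply Rmult_le_compat; lra. }
  assert (Hall : forall eps, 0 < eps -> 4 <= 8 * M / (q * Cmod l) + 8 * (eps / Cmod l)).
  { intros eps He; destruct (Hl eps He) as [d [Hd Hfd]].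
    (* The small square lies inside the large one and within distance [d] of [a], where the
       derivative estimate applies. *)
    set (s := Rmin q (d / 3)).
    assert (Hs : 0 < s) by (apply Rmin_pos; lra).
    assert (Hs1 : s <= q) by apply Rmin_l.
    assert (Hs2 : s <= d / 3) by apply Rmin_r.
    assert (HE : rint G (square a q) = rint G (square a s)).
    { apply rint_punctured_square; [lra|]; intros z Hz N; apply HG; [exact N|].
      apply in_square_dist in Hz; unfold q in Hz; lra. }
    assert (Hin : Cmod (rint (fun w => / (w - a))%C (square a s) - rint G (square a s))
                  <= 8 * (eps / Cmod l)).
    { replace (8 * (eps / Cmod l)) with (2 * semiperim (square a s) * (eps / (s * Cmod l)))
        by (unfold semiperim, square; simpl; field; lra).
      apply rint_minus_bound; [apply square_valid; exact Hs| |apply HGc; lra|].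
      - intros z Hz; destruct (HB s ltac:(lra) z Hz) as [_ [N D]].
        eapply cderiv_ccont; apply cderiv_inv_shift; exact N.
      - intros z Hz; destruct (HB s ltac:(lra) z Hz) as [[B1 B2] [N D]].
        assert (Hne := Cminus_neq_0 _ _ N).
        unfold G.
        replace (/ (z - a) - (f z - f a) * / l * (/ (z - a) * / (z - a)))%C
          with (- (f z - f a - l * (z - a)) * (/ l * (/ (z - a) * / (z - a))))%C
          by (field; split; assumption).
        rewrite !Cmod_mult, Cmod_opp, !Cmod_inv by assumption.
        specialize (Hfd z ltac:(lra)).
        assert (I : / Cmod (z - a) <= / s) by (apply Rinv_le_contravar; lra).
        assert (I0 : 0 < / Cmod (z - a)) by (apply Rinv_0_lt_compat; lra).
        assert (I1 : 0 < / Cmod l) by (apply Rinv_0_lt_compat; lra).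
        apply Rle_trans with (eps * Cmod (z - a) * (/ Cmod l * (/ Cmod (z - a) * / Cmod (z - a)))).
        + apply Rmult_le_compat_r; [|exact Hfd]; repeat apply Rmult_le_pos; lra.
        + replace (eps * Cmod (z - a) * (/ Cmod l * (/ Cmod (z - a) * / Cmod (z - a))))
            with (eps * / Cmod l * / Cmod (z - a)) by (field; lra).
          replace (eps / (s * Cmod l)) with (eps * / Cmod l * / s) by (field; lra).
          apply Rmult_le_compat_l; [apply Rmult_le_pos; lra|exact I]. }
    assert (H4 := rint_inv_square a s Hs).
    rewrite HE in Hout.
    assert (T := Cmod_triangle (rint (fun w => / (w - a))%C (square a s) - rint G (square a s))
                               (rint G (square a s))).
    replace (rint (fun w => / (w - a))%C (square a s) - rint G (square a s) + rint G (square a s))%C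
      with (rint (fun w => / (w - a))%C (square a s)) in T by ring.
    lra. }
  apply le_epsilon; intros e He.
  specialize (Hall (e / 2) ltac:(lra)).
  (* Scaling by [Cmod l / 4] isolates [Cmod l] on the left; on the right, [2 * M / q] is [6 * M / r]
     and the error term becomes [e]. *)
  apply Rmult_le_compat_r with (r := Cmod l / 4) in Hall; [|lra].
  replace ((8 * M / (q * Cmod l) + 8 * (e / 2 / Cmod l)) * (Cmod l / 4))
    with (6 * M / r + e) in Hall by (unfold q; field; lra).
  lra.
Qed.

(** * Mean value inequality, local solvability and Bloch's argument *)

Lemma Rabs_dot_le (u v : C) : Rabs (fst u * fst v + snd u * snd v) <= Cmod u * Cmod v.
Proof.
  replace (fst u * fst v + snd u * snd v) with (fst (Cconj u * v)%C) by (simpl; ring).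
  eapply Rle_trans; [apply Rabs_fst_le_Cmod|].
  rewrite Cmod_mult; apply Rmult_le_compat_r; [apply Cmod_ge_0|].
  right; apply Cmod_conj.
Qed.

(** The mean value theorem needs a real function: [phi] is the scalar product of [f] along the
    segment with [u = f w - f z]. Its total increment is [|u|^2], and Cauchy-Schwarz bounds its
    derivative by [|u| * K * |w - z|]. *)
Lemma mean_value_inequality (f D : C -> C) (z w : C) (K : R) :
  (forall t, 0 <= t <= 1 -> cderiv f (z + RtoC t * (w - z)) (D (z + RtoC t * (w - z))%C)
     /\ Cmod (D (z + RtoC t * (w - z))%C) <= K) ->
  Cmod (f w - f z) <= K * Cmod (w - z).
Proof.
  intros H; set (u := (f w - f z)%C); set (v := (w - z)%C).
  set (g := fun t => (z + RtoC t * v)%C).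
  set (phi := fun t => fst u * fst (f (g t)) + snd u * snd (f (g t))).
  set (dphi := fun t => fst u * fst (D (g t) * v)%C + snd u * snd (D (g t) * v)%C).
  assert (Hd : forall t, 0 <= t <= 1 -> is_derive phi t (dphi t)).
  { intros t Ht; destruct (H t Ht) as [Hc _]; apply is_derive_Reals; intros e He.
    assert (Hu := Cmod_ge_0 u); assert (Hv := Cmod_ge_0 v).
    set (k := (1 + Cmod u) * (1 + Cmod v)).
    assert (Hk : 0 < k) by (apply Rmult_lt_0_compat; lra).
    destruct (Hc (e / k)) as [d [Hd Hfd]]; [apply Rdiv_lt_0_compat; lra|].
    assert (Hd' : 0 < d / (1 + Cmod v)) by (apply Rdiv_lt_0_compat; lra).
    exists (mkposreal _ Hd'); intros s Hs0 Hs; simpl in Hs.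
    assert (Hgs : (g (t + s)%R - g t)%C = (RtoC s * v)%C)
      by (unfold g; rewrite RtoC_plus; ring).
    assert (As := Rabs_pos_lt s Hs0).
    assert (B : Cmod (g (t + s)%R - g t) < d).
    { rewrite Hgs, Cmod_mult, Cmod_R.
      apply Rle_lt_trans with (Rabs s * (1 + Cmod v)); [apply Rmult_le_compat_l; lra|].
      apply Rlt_le_trans with (d / (1 + Cmod v) * (1 + Cmod v)); [apply Rmult_lt_compat_r; lra|].
      right; field; lra. }
    specialize (Hfd _ B); change (z + RtoC t * (w - z))%C with (g t) in Hfd.
    set (E := (f (g (t + s)%R) - f (g t) - D (g t) * (g (t + s)%R - g t))%C) in Hfd.
    assert (HE : (phi (t + s) - phi t) / s - dphi t = (fst u * fst E + snd u * snd E) / s).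
    { unfold E; rewrite Hgs; unfold phi, dphi; simpl; field; exact Hs0. }
    rewrite HE; unfold Rdiv; rewrite Rabs_mult, Rabs_inv.
    apply Rmult_lt_reg_r with (Rabs s); [exact As|].
    rewrite Rmult_assoc, Rinv_l, Rmult_1_r by lra.
    eapply Rle_lt_trans; [apply Rabs_dot_le|].
    rewrite Hgs, Cmod_mult, Cmod_R in Hfd.
    apply Rle_lt_trans with (Cmod u * (e / k * (Rabs s * Cmod v)));
      [apply Rmult_le_compat_l; [exact Hu|exact Hfd]|].
    replace (Cmod u * (e / k * (Rabs s * Cmod v))) with (Cmod u * Cmod v * (e / k * Rabs s)) by ring.
    replace (e * Rabs s) with (k * (e / k * Rabs s)) by (field; lra).
    apply Rmult_lt_compat_r.
    - apply Rmult_lt_0_compat; [apply Rdiv_lt_0_compat; lra|exact As].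
    - unfold k; assert (0 <= Cmod u * Cmod v) by (apply Rmult_le_pos; lra); lra. }
  destruct (MVT_gen phi 0 1 dphi) as [t [Ht E]];
    rewrite ?Rmin_left, ?Rmax_right in * by lra.
  - intros t Ht; apply Hd; lra.
  - intros t Ht; apply derivable_continuous_pt; exists (dphi t); apply is_derive_Reals, Hd; lra.
  - assert (G1 : g 1 = w) by (unfold g, v; ring).
    assert (G0 : g 0 = z) by (unfold g, v; ring).
    assert (Hu2 : phi 1 - phi 0 = Cmod u * Cmod u).
    { unfold phi; rewrite G0, G1; unfold Cmod at 1 2.
      rewrite sqrt_def by (assert (A := pow2_ge_0 (fst u)); assert (B := pow2_ge_0 (snd u)); lra).
      unfold u; simpl; ring. }
    destruct (H t Ht) as [_ HK]; change (z + RtoC t * (w - z))%C with (g t) in HK.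
    assert (Hdb : dphi t <= Cmod u * (K * Cmod v)).
    { eapply Rle_trans; [apply Rle_abs|]; eapply Rle_trans; [apply Rabs_dot_le|].
      rewrite Cmod_mult; apply Rmult_le_compat_l; [apply Cmod_ge_0|].
      apply Rmult_le_compat_r; [apply Cmod_ge_0|exact HK]. }
    (* One factor [|u|] is cancelled, so the case [|u| = 0] is separate. *)
    destruct (Cmod_ge_0 u) as [Hup|Hu0].
    + apply Rmult_le_reg_l with (Cmod u); [exact Hup|]; lra.
    + rewrite <- Hu0; apply Rmult_le_pos; [|apply Cmod_ge_0].
      eapply Rle_trans; [apply Cmod_ge_0|exact HK].
Qed.

Lemma le_0_of_pow_half (x K : R) : (forall n, x <= K * (/ 2) ^ n) -> x <= 0.
Proof.
  intros H; apply Rnot_lt_le; intros Hx.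
  destruct (pow_half_small K x Hx) as [n Hn]; specialize (H n); lra.
Qed.

(** Banach iteration from [a]. The disc is preserved because the displacement of [a] and the
    contraction each account for at most [rho / 2]. *)
Lemma contraction_fixed_point (T : C -> C) (a : C) (rho : R) :
  0 < rho ->
  (forall w w', Cmod (w - a) <= rho -> Cmod (w' - a) <= rho ->
     Cmod (T w - T w') <= Cmod (w - w') / 2) ->
  Cmod (T a - a) <= rho / 2 ->
  exists w, Cmod (w - a) <= rho /\ T w = w.
Proof.
  intros Hr HT Ha.
  assert (Haa : Cmod (a - a) <= rho) by (rewrite Cmod_minus_diag; lra).
  set (u := fun n => Nat.iter n T a).
  assert (Hu : forall n, Cmod (u n - a) <= rho).
  { induction n as [|n IH]; [exact Haa|].
    change (u (S n)) with (T (u n)).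
    eapply Rle_trans; [apply (Cmod_minus_triangle _ (T a))|].
    specialize (HT _ _ IH Haa); lra. }
  assert (Hstep : forall n, Cmod (u (S n) - u n) <= rho / 2 * (/ 2) ^ n).
  { induction n as [|n IH]; [simpl; lra|].
    change (u (S (S n))) with (T (u (S n))); change (u (S n)) with (T (u n)) at 2.
    eapply Rle_trans; [apply HT; apply Hu|]; simpl pow; lra. }
  assert (Hpow : forall n, 0 < (/ 2) ^ n) by (intros n; apply pow_lt; lra).
  (* Each coordinate converges by nested intervals: the steps [rho / 2 * (/ 2) ^ n] fit exactly the
     shrinking of the radii [rho * (/ 2) ^ n]. *)
  assert (Hlim : forall p : C -> R, (forall z w, Rabs (p z - p w) <= Cmod (z - w)) ->
    exists x, forall n, p (u n) - rho * (/ 2) ^ n <= x <= p (u n) + rho * (/ 2) ^ n).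
  { intros p Hp; apply nested_intervals; intros n;
      assert (B := Hpow n); try (assert (0 < rho * (/ 2) ^ n) by (apply Rmult_lt_0_compat; lra); lra);
      assert (D := Hp (u (S n)) (u n)); specialize (Hstep n);
      assert (D' : Rabs (p (u (S n)) - p (u n)) <= rho / 2 * (/ 2) ^ n) by lra;
      apply Rabs_le_between in D'; simpl pow; lra. }
  destruct (Hlim fst) as [x Hx]; [intros z w; exact (Rabs_fst_le_Cmod (z - w)%C)|].
  destruct (Hlim snd) as [y Hy]; [intros z w; exact (Rabs_snd_le_Cmod (z - w)%C)|].
  assert (HL : forall n, Cmod ((x, y) - u n) <= 2 * rho * (/ 2) ^ n).
  { intros n; eapply Rle_trans; [apply Cmod_le_Rabs_plus|]; simpl.
    assert (Rabs (x + - fst (u n)) <= rho * (/ 2) ^ n) by (apply Rabs_le; specialize (Hx n); lra).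
    assert (Rabs (y + - snd (u n)) <= rho * (/ 2) ^ n) by (apply Rabs_le; specialize (Hy n); lra).
    lra. }
  assert (HLa : Cmod ((x, y) - a) <= rho).
  { cut (Cmod ((x, y) - a) - rho <= 0); [lra|].
    apply le_0_of_pow_half with (2 * rho); intros n.
    assert (A := Cmod_minus_triangle (x, y) (u n) a); specialize (HL n); specialize (Hu n); lra. }
  exists (x, y); split; [exact HLa|].
  apply Ceq_minus, Cmod_eq_0, Rle_antisym; [|apply Cmod_ge_0].
  apply le_0_of_pow_half with (2 * rho); intros n.
  assert (A := Cmod_minus_triangle (T (x, y)) (u (S n)) (x, y)).
  assert (B := HT _ _ HLa (Hu n)); change (T (u n)) with (u (S n)) in B.
  rewrite (Cmod_minus_sym (u (S n))) in A.
  assert (E := HL n); assert (E' := HL (S n)); simpl pow in E'; lra.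
Qed.

Lemma segment_dist (z w : C) (t : R) :
  0 <= t <= 1 -> Cmod (z + RtoC t * (w - z) - z) <= Cmod (w - z).
Proof.
  intros Ht; replace (z + RtoC t * (w - z) - z)%C with (RtoC t * (w - z))%C by ring.
  rewrite Cmod_mult, Cmod_R, Rabs_pos_eq by lra.
  assert (H := Cmod_ge_0 (w - z)).
  assert (t * Cmod (w - z) <= 1 * Cmod (w - z)) by (apply Rmult_le_compat_r; lra); lra.
Qed.

Lemma segment_disc (a z w : C) (r t : R) :
  0 <= t <= 1 -> Cmod (z - a) <= r -> Cmod (w - a) <= r ->
  Cmod (z + RtoC t * (w - z) - a) <= r.
Proof.
  intros Ht Hz Hw.
  replace (z + RtoC t * (w - z) - a)%C with (RtoC (1 - t) * (z - a) + RtoC t * (w - a))%C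
    by (rewrite RtoC_minus; ring).
  eapply Rle_trans; [apply Cmod_triangle|].
  rewrite !Cmod_mult, !Cmod_R, !Rabs_pos_eq by lra.
  assert ((1 - t) * Cmod (z - a) <= (1 - t) * r) by (apply Rmult_le_compat_l; lra).
  assert (t * Cmod (w - a) <= t * r) by (apply Rmult_le_compat_l; lra); lra.
Qed.

(* The Cauchy estimate is applied to the translation differences of [f], so that no
   second derivative is needed. *)
Lemma derivative_lipschitz (f D : C -> C) (a e : C) (r K : R) :
  0 < r -> Cmod e <= r ->
  (forall w, Cmod (w - a) < 2 * r -> cderiv f w (D w) /\ Cmod (D w) <= K) ->
  Cmod (D (a + e)%C - D a) <= 12 * K * Cmod e / r.
Proof.
  intros Hr He HD.
  assert (Hinc : forall v, Cmod (v - a) < r -> Cmod (f (v + e)%C - f v) <= K * Cmod e).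
  { intros v Hv; replace (Cmod e) with (Cmod (v + e - v)) by (f_equal; ring).
    apply mean_value_inequality with D; intros t Ht; apply HD.
    eapply Rle_lt_trans; [apply (Cmod_minus_triangle _ v)|].
    assert (T := segment_dist v (v + e) t Ht).
    replace (v + e - v)%C with e in * by ring; lra. }
  (* The increment of [f] over [e] is at most [K * Cmod e] on the disc of radius [r], so it varies
     by at most twice that; the Cauchy estimate contributes [6 / r]. *)
  replace (12 * K * Cmod e / r) with (6 * (2 * (K * Cmod e)) / r) by (field; lra).
  apply cauchy_estimate with (f := fun v => (f (v + e) - f v)%C) (a := a); [exact Hr| | |].
  - intros w Hw; exists (D (w + e)%C - D w)%C.
    apply (cderiv_minus (fun v => f (v + e)%C) f).
    + apply cderiv_shift, HD.
      eapply Rle_lt_trans; [apply (Cmod_minus_triangle _ w)|].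
      replace (w + e - w)%C with e by ring; lra.
    + apply HD; lra.
  - intros w Hw; unfold Cminus at 1; eapply Rle_trans; [apply Cmod_triangle|].
    rewrite Cmod_opp.
    assert (A := Hinc w Hw); assert (B := Hinc a); rewrite Cmod_minus_diag in B.
    specialize (B Hr); lra.
  - apply (cderiv_minus (fun v => f (v + e)%C) f).
    + apply cderiv_shift, HD; replace (a + e - a)%C with e by ring; lra.
    + apply HD; rewrite Cmod_minus_diag; lra.
Qed.

(** Newton's map with frozen derivative, [w - (f w - v) / D a], has derivative [1 - D w / D a] of
    modulus at most [1 / 2], hence contracts the disc; its fixed point solves the equation. *)
Lemma solve_near (f D : C -> C) (a v : C) (rho : R) :
  0 < rho -> D a <> RtoC 0 ->
  (forall w, Cmod (w - a) <= rho -> cderiv f w (D w) /\ Cmod (D w - D a) <= Cmod (D a) / 2) ->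
  Cmod (v - f a) <= Cmod (D a) * rho / 2 ->
  exists w, Cmod (w - a) <= rho /\ f w = v.
Proof.
  intros Hr H0 HD Hv.
  assert (HA : 0 < Cmod (D a)) by now apply Cmod_gt_0.
  set (g := fun w => (w + - / D a * f w)%C).
  destruct (contraction_fixed_point (fun w => (g w + / D a * v)%C) a rho Hr) as [w [Hw E]].
  - intros w w' Hw Hw'.
    replace (g w + / D a * v - (g w' + / D a * v))%C with (g w - g w')%C by ring.
    replace (Cmod (w - w') / 2) with (/ 2 * Cmod (w - w')) by field.
    apply mean_value_inequality with (fun u => (1 + - / D a * D u)%C); intros t Ht.
    assert (Hseg := segment_disc a w' w rho t Ht Hw' Hw).
    destruct (HD _ Hseg) as [H1 H2]; split.
    + apply (cderiv_lin (fun u => u) f); [apply cderiv_id|exact H1].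
    + set (z := (w' + t * (w - w'))%C) in *.
      replace (1 + - / D a * D z)%C with (- ((D z - D a) / D a))%C by (field; exact H0).
      rewrite Cmod_opp, Cmod_div by exact H0.
      apply Rmult_le_reg_r with (Cmod (D a)); [exact HA|].
      replace (Cmod (D z - D a) / Cmod (D a) * Cmod (D a)) with (Cmod (D z - D a)) by (field; lra).
      lra.
  - replace (g a + / D a * v - a)%C with ((v - f a) / D a)%C by (unfold g; field; exact H0).
    rewrite Cmod_div by exact H0.
    apply Rmult_le_reg_r with (Cmod (D a)); [exact HA|].
    replace (Cmod (v - f a) / Cmod (D a) * Cmod (D a)) with (Cmod (v - f a)) by (field; lra); lra.
  - exists w; split; [exact Hw|].
    assert (E' : (f w - v = D a * (w - (g w + / D a * v)))%C) by (unfold g; field; exact H0).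
    rewrite E in E'; apply Ceq_minus; rewrite E'; ring.
Qed.

(* Bloch's argument: a point that nearly maximizes [|f'(w)| * (r - |w - z0|)] has a disc on which
   [f'] is nearly constant, whose image contains a disc of radius comparable to the maximum. *)
Lemma bloch_unit_translate (f D : C -> C) (z0 : C) (r : R) :
  0 < r -> (forall w, Cmod (w - z0) < 4 * r -> cderiv f w (D w)) ->
  (forall a w, Cmod (a - z0) < r -> Cmod (w - z0) < r -> f w <> (f a + 1)%C) ->
  Cmod (D z0) <= 1536 / r.
Proof.
  intros HR HD Hom; apply Rnot_lt_le; intros Hbig.
  assert (HbigR : 1536 < Cmod (D z0) * r).
  { apply Rmult_lt_compat_r with (r := r) in Hbig; [|exact HR].
    replace (1536 / r * r) with 1536 in Hbig by (field; lra); exact Hbig. }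
  (* A bound on [f] gives, by the Cauchy estimate on discs of radius [r / 2], a bound on [D], so the
     supremum [S] below is finite. The square stays within [3 * r] of [z0]. *)
  destruct (ccont_bounded_on_rect f (square z0 (3 * r / 2))) as [M0 HM0].
  { apply square_valid; lra. }
  { intros z Hz; apply in_square_dist in Hz; eapply cderiv_ccont; apply HD; lra. }
  assert (HDb : forall p, Cmod (p - z0) < r -> Cmod (D p) <= 6 * (2 * M0) / (r / 2)).
  { intros p Hp.
    assert (Hpw : forall w, Cmod (w - p) < r / 2 -> Cmod (w - z0) <= 3 * r / 2).
    { intros w Hw; assert (T := Cmod_minus_triangle w p z0); lra. }
    apply cauchy_estimate with (f := f) (a := p); [lra| | |apply HD; lra].
    - intros w Hw; exists (D w); apply HD; specialize (Hpw w Hw); lra.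
    - intros w Hw; unfold Cminus at 1; eapply Rle_trans; [apply Cmod_triangle|]; rewrite Cmod_opp.
      assert (A := HM0 w (in_square_of_dist _ _ _ (Hpw w Hw))).
      assert (B := HM0 p (in_square_of_dist z0 p (3 * r / 2) ltac:(lra))); lra. }
  set (E := fun y => exists z, Cmod (z - z0) < r /\ y = Cmod (D z) * (r - Cmod (z - z0))).
  assert (HM1 : 0 <= 6 * (2 * M0) / (r / 2)).
  { eapply Rle_trans; [apply (Cmod_ge_0 (D z0))|]; apply HDb; rewrite Cmod_minus_diag; lra. }
  destruct (completeness E) as [S [HS1 HS2]].
  { exists (6 * (2 * M0) / (r / 2) * r); intros y [z [Hz ->]].
    assert (A := Cmod_ge_0 (z - z0)).
    apply Rmult_le_compat; [apply Cmod_ge_0|lra|apply HDb; exact Hz|lra]. }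
  { exists (Cmod (D z0) * (r - Cmod (z0 - z0))), z0; split; [rewrite Cmod_minus_diag; lra|reflexivity]. }
  assert (HS : 1536 < S).
  { eapply Rlt_le_trans; [exact HbigR|]; apply HS1; exists z0; rewrite Cmod_minus_diag.
    split; [lra|f_equal; lra]. }
  (* The supremum need not be attained; a point reaching more than half of it suffices. *)
  assert (Ha : exists a, Cmod (a - z0) < r /\ S / 2 < Cmod (D a) * (r - Cmod (a - z0))).
  { apply NNPP; intros N.
    assert (S <= S / 2); [|lra].
    apply HS2; intros y [z [Hz ->]]; apply Rnot_lt_le; intros Hlt; apply N; exists z; auto. }
  destruct Ha as [a [Ha1 Ha2]].
  (* On the disc of radius [t] around [a] the weight [r - Cmod (z - z0)] still exceeds [t], so there
     [D] is at most [S / t], which is below [4 * Cmod (D a)]. *)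
  set (t := (r - Cmod (a - z0)) / 2).
  assert (Ht : 0 < t) by (unfold t; lra).
  assert (Hat : S < 4 * (Cmod (D a) * t)) by (unfold t; lra).
  assert (HA : 0 < Cmod (D a)).
  { destruct (Cmod_ge_0 (D a)) as [H|H]; [exact H|]; rewrite <- H in Hat; lra. }
  assert (Hnear : forall z, Cmod (z - a) < t -> Cmod (z - z0) < r - t).
  { intros z Hz; assert (T := Cmod_minus_triangle z a z0); unfold t in *; lra. }
  assert (HD4 : forall z, Cmod (z - a) < t -> Cmod (D z) <= 4 * Cmod (D a)).
  { intros z Hz; specialize (Hnear z Hz).
    apply Rmult_le_reg_r with t; [exact Ht|].
    apply Rle_trans with (Cmod (D z) * (r - Cmod (z - z0))).
    - apply Rmult_le_compat_l; [apply Cmod_ge_0|lra].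
    - apply Rle_trans with S; [|lra]; apply HS1; exists z; split; [lra|reflexivity]. }
  (* Within [t / 192] of [a], the Lipschitz bound with radius [t / 2] and constant [4 * Cmod (D a)]
     lets [D] vary by at most [Cmod (D a) / 2]. The values then fill a disc of radius
     [Cmod (D a) * t / 384], which exceeds 1 because [S > 1536 = 4 * 384]. *)
  destruct (solve_near f D a (f a + 1) (t / 192)) as [w [Hw Ew]].
  - lra.
  - now apply Cmod_gt_0.
  - intros w Hw; split; [apply HD; specialize (Hnear w ltac:(lra)); lra|].
    assert (L := derivative_lipschitz f D a (w - a) (t / 2) (4 * Cmod (D a))).
    replace (a + (w - a))%C with w in L by ring.
    eapply Rle_trans; [apply L; [lra|lra|]|].
    + intros u Hu; split; [apply HD; specialize (Hnear u ltac:(lra)); lra|apply HD4; lra].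
    + apply Rle_trans with (12 * (4 * Cmod (D a)) * (t / 192) / (t / 2)); [|right; field; lra].
      apply Rmult_le_compat_r; [left; apply Rinv_0_lt_compat; lra|].
      apply Rmult_le_compat_l; lra.
  - replace (f a + 1 - f a)%C with (RtoC 1) by ring; rewrite Cmod_1; lra.
  - apply (Hom a w Ha1); [|exact Ew].
    specialize (Hnear w ltac:(lra)); lra.
Qed.

(** * Decay of periodic functions *)

Lemma Im_dist (z w : C) : Rabs (Im z - Im w) <= Cmod (z - w).
Proof. exact (Rabs_snd_le_Cmod (z - w)). Qed.

Lemma Rabs_Im_near (z w : C) (Y r : R) :
  Rabs (Im z) <= Y - r -> Cmod (w - z) <= r -> Rabs (Im w) <= Y.
Proof.
  intros Hz Hw; assert (A := Im_dist w z).
  replace (Im w) with (Im z + (Im w - Im z)) by ring.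
  eapply Rle_trans; [apply Rabs_triang|]; lra.
Qed.

(** The mean-zero property of [D] is used without integration: by periodicity [u] changes by exactly
    [- D z] over one period, while its derivative there is [D (z + e) - D z]. Radius 24 makes that
    at most [12 * K / 24], and requires a disc of radius 48 in the strip. *)
Lemma periodic_derivative_halving (h D : C -> C) (Y K : R) :
  (forall z, Rabs (Im z) <= Y -> cderiv h z (D z) /\ Cmod (D z) <= K) ->
  (forall z, Rabs (Im z) <= Y -> h (z + 1)%C = h z) ->
  forall z, Rabs (Im z) <= Y - 48 -> Cmod (D z) <= K / 2.
Proof.
  intros HD Hper z Hz.
  assert (HY : Rabs (Im z) <= Y) by lra.
  set (u := fun w => (h w + - D z * w)%C).
  assert (Hu : Cmod (u (z + 1)%C - u z) <= K / 2 * Cmod (z + 1 - z)).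
  { apply mean_value_inequality with (fun w => (D w + - D z * 1)%C); intros t Ht.
    set (e := (RtoC t * (z + 1 - z))%C).
    assert (He : Cmod e <= 1).
    { unfold e; replace (z + 1 - z)%C with (RtoC 1) by ring.
      rewrite Cmod_mult, !Cmod_R, Rabs_R1, Rabs_pos_eq; lra. }
    split.
    - apply (cderiv_lin h (fun w => w)); [|apply cderiv_id].
      apply HD; apply (Rabs_Im_near z _ Y 1); [lra|].
      replace (z + e - z)%C with e by ring; exact He.
    - replace (D (z + e)%C + - D z * 1)%C with (D (z + e)%C - D z)%C by ring.
      eapply Rle_trans; [apply (derivative_lipschitz h D z e 24 K); [lra|lra|]|].
      + intros w Hw; apply HD; apply (Rabs_Im_near z w Y 48); lra.
      + assert (HK : 0 <= K) by (eapply Rle_trans; [apply Cmod_ge_0|apply (HD z HY)]).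
        assert (K * Cmod e <= K * 1) by (apply Rmult_le_compat_l; lra); lra. }
  replace (u (z + 1)%C - u z)%C with (- D z)%C in Hu
    by (unfold u; rewrite (Hper z HY); ring).
  replace (z + 1 - z)%C with (RtoC 1) in Hu by ring.
  rewrite Cmod_opp, Cmod_1 in Hu; lra.
Qed.

Lemma periodic_derivative_decay (h D : C -> C) (Y K : R) :
  (forall z, Rabs (Im z) <= Y -> cderiv h z (D z) /\ Cmod (D z) <= K) ->
  (forall z, Rabs (Im z) <= Y -> h (z + 1)%C = h z) ->
  forall n z, Rabs (Im z) <= Y - 48 * INR n ->
    cderiv h z (D z) /\ Cmod (D z) <= K * (/ 2) ^ n.
Proof.
  intros HD Hper n; induction n as [|n IH]; intros z Hz.
  - simpl in *; rewrite Rmult_1_r; apply HD; lra.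
  - rewrite S_INR in Hz; assert (Hn := pos_INR n); split; [apply HD; lra|].
    replace (K * (/ 2) ^ S n) with (K * (/ 2) ^ n / 2) by (simpl; field).
    apply (periodic_derivative_halving h D (Y - 48 * INR n)); [exact IH| |lra].
    intros w Hw; apply Hper; lra.
Qed.

Lemma Im_segment (z w : C) (t Y : R) :
  0 <= t <= 1 -> Rabs (Im z) <= Y -> Rabs (Im w) <= Y ->
  Rabs (Im (z + RtoC t * (w - z))%C) <= Y.
Proof.
  intros Ht Hz Hw; apply Rabs_le_between in Hz; apply Rabs_le_between in Hw.
  replace (Im (z + RtoC t * (w - z))%C) with ((1 - t) * Im z + t * Im w)
    by (unfold Im; simpl; ring).
  apply Rabs_le; split.
  - assert ((1 - t) * - Y <= (1 - t) * Im z) by (apply Rmult_le_compat_l; lra).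
    assert (t * - Y <= t * Im w) by (apply Rmult_le_compat_l; lra); lra.
  - assert ((1 - t) * Im z <= (1 - t) * Y) by (apply Rmult_le_compat_l; lra).
    assert (t * Im w <= t * Y) by (apply Rmult_le_compat_l; lra); lra.
Qed.

Lemma periodic_oscillation (h D : C -> C) (Y K : R) :
  (forall z, Rabs (Im z) <= Y -> cderiv h z (D z) /\ Cmod (D z) <= K) ->
  (forall z, Rabs (Im z) <= Y -> h (z + 1)%C = h z) ->
  forall n z, 0 <= Re z <= 1 -> Rabs (Im z) <= Y - 48 * INR n ->
    Cmod (h z - h 0) <= 97 * K * (/ 2) ^ n.
Proof.
  intros HD Hper.
  assert (Hseg : forall n z w, Rabs (Im z) <= Y - 48 * INR n -> Rabs (Im w) <= Y - 48 * INR n ->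
    Cmod (h w - h z) <= K * (/ 2) ^ n * Cmod (w - z)).
  { intros n z w Hz Hw; apply mean_value_inequality with D; intros t Ht.
    apply (periodic_derivative_decay h D Y K HD Hper); apply Im_segment; assumption. }
  (* [m] counts vertical steps of length 48 down to the real axis, and [n] measures depth in the
     strip. Each step doubles the gain, so the path costs at most [48 * (1 + 1/2 + 1/4 + ...) = 96]
     times [K * (/ 2) ^ n]. *)
  assert (Hvert : forall m n y, Rabs y <= Y - 48 * INR n -> Rabs y <= 48 * INR m ->
    Cmod (h (0, y) - h 0) <= 96 * K * (/ 2) ^ n).
  { assert (HK : forall n y, Rabs y <= Y - 48 * INR n -> 0 <= K * (/ 2) ^ n).
    { intros n y Hy; assert (Hn := pos_INR n); apply Rmult_le_pos; [|left; apply pow_lt; lra].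
      eapply Rle_trans; [apply Cmod_ge_0|apply (HD (0, y)); simpl; lra]. }
    induction m as [|m IH]; intros n y Hy Hm; specialize (HK n y Hy).
    - simpl in Hm; rewrite Rmult_0_r in Hm.
      assert (E : y = 0) by (apply Rabs_le_between in Hm; lra); subst y.
      change ((0, 0) : C) with (RtoC 0); rewrite Cmod_minus_diag; lra.
    - rewrite S_INR in Hm.
      assert (Hdist : forall x, Cmod ((0, y) - (0, x)) <= Rabs (y - x)).
      { intros x; eapply Rle_trans; [apply Cmod_le_Rabs_plus|]; simpl.
        replace (0 + - 0) with 0 by ring; rewrite Rabs_R0; unfold Rminus; lra. }
      (* [y'] is [y] moved by 48 towards 0, or 0 itself when [y] is that close. *)
      assert (Hy' : exists y', Rabs (y - y') <= 48 /\
        (y' = 0 \/ Rabs y' = Rabs y - 48)).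
      { destruct (Rle_dec (Rabs y) 48) as [H|H].
        - exists 0; rewrite Rminus_0_r; auto.
        - destruct (Rle_dec 0 y) as [H'|H'].
          + rewrite (Rabs_pos_eq y) in * by lra.
            exists (y - 48); rewrite (Rabs_pos_eq (y - 48)) by lra.
            split; [apply Rabs_le; lra|auto].
          + rewrite (Rabs_left y) in * by lra.
            exists (y + 48); rewrite (Rabs_left1 (y + 48)) by lra.
            split; [apply Rabs_le; lra|right; ring]. }
      destruct Hy' as [y' [Hyy' Hcase]].
      assert (Hys : Rabs y' <= Y - 48 * INR n).
      { destruct Hcase as [->| ->]; [rewrite Rabs_R0; assert (A := Rabs_pos y); lra|lra]. }
      assert (Hfirst : Cmod (h (0, y) - h (0, y')) <= 48 * (K * (/ 2) ^ n)).
      { eapply Rle_trans; [apply (Hseg n); simpl; assumption|].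
        specialize (Hdist y'); rewrite Rmult_comm; apply Rmult_le_compat_r; lra. }
      destruct Hcase as [->|Hc].
      + change ((0, 0) : C) with (RtoC 0) in Hfirst; lra.
      + assert (Hsecond := IH (S n) y').
        rewrite S_INR in Hsecond; specialize (Hsecond ltac:(lra) ltac:(lra)).
        simpl pow in Hsecond.
        eapply Rle_trans; [apply (Cmod_minus_triangle _ (h (0, y')))|]; lra. }
  intros n z Hre Him.
  destruct (INR_unbounded (Rabs (Im z))) as [m Hm].
  assert (Hv := Hvert m n (Im z) Him ltac:(assert (A := pos_INR m); lra)).
  (* A horizontal segment of length at most 1 joins the imaginary axis to [z] and accounts for the
     step from 96 to 97. *)
  assert (Hh := Hseg n (0, Im z) z Him Him).
  assert (Hdist : Cmod (z - (0, Im z)) <= 1).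
  { eapply Rle_trans; [apply Cmod_le_Rabs_plus|]; destruct z as [x y]; simpl in *.
    replace (y + - y) with 0 by ring; rewrite Rabs_R0, Rabs_pos_eq; lra. }
  assert (HK : 0 <= K * (/ 2) ^ n).
  { eapply Rle_trans; [apply Cmod_ge_0|apply (periodic_derivative_decay h D Y K HD Hper n z Him)]. }
  assert (K * (/ 2) ^ n * Cmod (z - (0, Im z)) <= K * (/ 2) ^ n * 1)
    by (apply Rmult_le_compat_l; lra).
  eapply Rle_trans; [apply (Cmod_minus_triangle _ (h (0, Im z)))|]; lra.
Qed.

(** * From the strip to the cylinder *)

Lemma periodic_Z (h : C -> C) (P : R -> Prop) :
  (forall z, P (Im z) -> h (z + 1)%C = h z) ->
  forall (k : Z) z, P (Im z) -> h (z + RtoC (IZR k))%C = h z.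
Proof.
  intros Hper.
  assert (Hn : forall (n : nat) z, P (Im z) -> h (z + RtoC (INR n))%C = h z).
  { induction n as [|n IH]; intros z Hz.
    - simpl; f_equal; ring.
    - rewrite S_INR, RtoC_plus.
      replace (z + (RtoC (INR n) + 1))%C with (z + RtoC (INR n) + 1)%C by ring.
      rewrite Hper; [auto|].
      replace (Im (z + RtoC (INR n))%C) with (Im z) by (unfold Im; simpl; ring); exact Hz. }
  intros k z Hz; destruct (Z.le_gt_cases 0 k) as [Hk|Hk].
  - rewrite <- (Z2Nat.id k) by lia; rewrite <- INR_IZR_INZ; auto.
  (* For negative [k], the natural case is applied to the translated point, which has the same
     imaginary part. *)
  - replace k with (- Z.of_nat (Z.to_nat (- k)))%Z by lia.
    rewrite opp_IZR, <- INR_IZR_INZ, RtoC_opp.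
    rewrite <- (Hn (Z.to_nat (- k)) (z + - RtoC (INR (Z.to_nat (- k))))%C).
    + f_equal; ring.
    + replace (Im (z + - RtoC (INR (Z.to_nat (- k))))%C) with (Im z) by (unfold Im; simpl; ring); exact Hz.
Qed.

(** Shrinking the radius to the distance from the edge of the strip makes the limit relative to the
    strip a limit over a full disc. *)
Lemma holo_on_strip_cderiv (b : R) (f : C -> C) (z : C) :
  holo_on (strip b) f -> strip b z -> exists l, cderiv f z l.
Proof.
  intros Hf Hz; destruct (Hf z Hz) as [l Hl]; exists l; intros eps He.
  destruct (Hl eps He) as [d [Hd Hfd]]; unfold strip in Hz.
  exists (Rmin d (b - Rabs (Im z))); split; [apply Rmin_pos; lra|]; intros w Hw.
  assert (A := Rmin_l d (b - Rabs (Im z))); assert (B := Rmin_r d (b - Rabs (Im z))).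
  destruct (Ceq_dec w z) as [->|N].
  { replace (f z - f z - l * (z - z))%C with (RtoC 0) by ring.
    rewrite Cmod_0, Cmod_minus_diag; lra. }
  assert (Hne := Cminus_neq_0 _ _ N).
  assert (Hp : 0 < Cmod (w - z)) by now apply Cmod_gt_0.
  assert (Hws : strip b w).
  { unfold strip; replace (Im w) with (Im z + (Im w - Im z)) by ring.
    eapply Rle_lt_trans; [apply Rabs_triang|]; assert (I := Im_dist w z); lra. }
  specialize (Hfd w Hws ltac:(lra)).
  replace (f w - f z - l * (w - z))%C with (((f w - f z) / (w - z) - l) * (w - z))%C
    by (field; exact Hne).
  rewrite Cmod_mult; apply Rmult_le_compat_r; lra.
Qed.

(** If [Phi w = Phi a + 1] inside the small disc, injectivity on the quotient makes [w - a] an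
    integer of modulus below 1, so [w = a], which is absurd. *)
Lemma embedding_derivative_bound (b : R) (Phi D : C -> C) (z : C) :
  lift_of_conformal_embedding b Phi ->
  (forall w, strip b w -> cderiv Phi w (D w)) ->
  Rabs (Im z) <= b - 1 -> Cmod (D z) <= 6144.
Proof.
  intros [_ [_ Hinj]] HD Hz.
  assert (Hstrip : forall w, Cmod (w - z) < 1 -> strip b w).
  { intros w Hw; unfold strip; replace (Im w) with (Im z + (Im w - Im z)) by ring.
    eapply Rle_lt_trans; [apply Rabs_triang|]; assert (I := Im_dist w z); lra. }
  (* Bloch's argument with [r = 1 / 4] uses differentiability on the disc of radius [4 * r = 1],
     which the distance to the edge allows. *)
  replace 6144 with (1536 / (1 / 4)) by field.
  apply bloch_unit_translate with Phi; [lra| |].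
  - intros w Hw; apply HD, Hstrip; lra.
  - intros a w Ha Hw E.
    destruct (Hinj w a) as [k Hk]; [apply Hstrip; lra|apply Hstrip; lra| |].
    + exists 1%Z; rewrite E; ring.
    + assert (T := Cmod_minus_triangle w z a); rewrite (Cmod_minus_sym z a) in T.
      assert (Hk1 : Rabs (IZR k) < 1) by (rewrite <- Cmod_R, <- Hk; lra).
      assert (k = 0%Z).
      { rewrite <- abs_IZR in Hk1; apply lt_IZR in Hk1; lia. }
      subst k; apply Ceq_minus in Hk; subst a.
      apply C1_nz; replace (RtoC 1) with (Phi w + 1 - Phi w)%C by ring.
      rewrite <- E; ring.
Qed.

Theorem theorem6p1 (eps : R) (heps : 0 < eps) :
  exists c : R, 0 < c /\
    forall (b : R) (Phi : C -> C),
      c < b ->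
      lift_of_conformal_embedding b Phi ->
      cyl_eq (Phi 0) 0 ->
      forall z : C, strip (b - c) z -> cyl_dist_le (Phi z) z eps.
Proof.
  (* [6145 = 6144 + 1] bounds the derivative of [Phi z - z], and [n] is the number of halvings that
     brings the oscillation below [eps]. *)
  destruct (pow_half_small (97 * 6145) eps heps) as [n Hn].
  assert (Hn0 := pos_INR n).
  (* A margin of 1 is spent on the derivative bound and 48 on each halving. *)
  exists (1 + 48 * INR n); split; [lra|]; intros b Phi Hb HPhi [k0 Hk0] z Hz.
  assert (HPhi' := HPhi); destruct HPhi' as [Hholo [Htrans _]].
  (* Derivatives are selected pointwise, with the default 0 off the strip. *)
  destruct (functional_choice (fun z l : C => strip b z -> cderiv Phi z l)) as [D HD].
  { intros w; destruct (classic (strip b w)) as [Hw|Hw].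
    - destruct (holo_on_strip_cderiv b Phi w Hholo Hw) as [l Hl]; exists l; auto.
    - exists (RtoC 0); tauto. }
  set (h := fun w => (Phi w - w)%C).
  assert (HDh : forall w, Rabs (Im w) <= b - 1 ->
    cderiv h w (D w - 1) /\ Cmod (D w - 1) <= 6145).
  { intros w Hw; split.
    - apply (cderiv_minus Phi (fun v => v)); [apply HD; unfold strip; lra|apply cderiv_id].
    - unfold Cminus; eapply Rle_trans; [apply Cmod_triangle|]; rewrite Cmod_opp, Cmod_1.
      assert (A := embedding_derivative_bound b Phi D w HPhi HD Hw); lra. }
  assert (Hper : forall w, Rabs (Im w) <= b - 1 -> h (w + 1)%C = h w).
  { intros w Hw; unfold h; rewrite Htrans by (unfold strip; lra); ring. }
  unfold strip in Hz.
  (* The oscillation bound covers one period, so [z] is first translated by an integer to real part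
     in [[0, 1)]. *)
  set (k := Int_part (Re z)); destruct (base_Int_part (Re z)) as [Hk1 Hk2]; fold k in Hk1, Hk2.
  set (z' := (z + RtoC (IZR (- k)))%C).
  assert (Him : Im z' = Im z) by (unfold z', Im; simpl; ring).
  assert (Hre : Re z' = Re z - IZR k) by (unfold z', Re; rewrite opp_IZR; simpl; ring).
  assert (Hosc := periodic_oscillation h (fun w => D w - 1)%C (b - 1) 6145 HDh Hper n z').
  rewrite Him, Hre in Hosc; specialize (Hosc ltac:(lra) ltac:(lra)).
  unfold z' in Hosc.
  rewrite (periodic_Z h (fun y => Rabs y <= b - 1) Hper) in Hosc by lra.
  (* The lift may send 0 to a nonzero integer; since [h 0 = k0], this is the translate that realises
     the distance bound. *)
  exists k0.
  replace (Phi z - z - RtoC (IZR k0))%C with (h z - h 0)%C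
    by (rewrite <- Hk0; unfold h; ring).
  lra.
Qed.
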